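(* There exists a function $f:\mathbb{N}^3\to\mathbb{N}$ such that the following holds. Let $c$ be a positive integer, $p$ a prime, $k\ge 3$ an integer, and let $A$ be an elementary abelian group of order $p^{k}$ acting by automorphisms on a finite $p'$-group $G$. Suppose that $\gamma_{k-2}(C_G(a))$ is nilpotent of class at most $c$ for every $a\in A^{\#}$. Then $\gamma_{k-2}(G)$ is nilpotent, of nilpotency class at most $f(c,k,p)$.
   Context: A finite $p'$-group is a finite group whose order is not divisible by $p$. The action of $A$ on $G$ is by automorphisms and need not be faithful. $A^{\#}$ denotes the set of non-identity elements of $A$. For $a\in A$, $C_G(a)=\{x\in G : x^a=x\}$ is the subgroup of elements of $G$ fixed by $a$. For a group $H$, $\gamma_i(H)$ denotes the $i$th term of the lower central series: $\gamma_1(H)=H$ and $\gamma_i(H)=[\gamma_{i-1}(H),H]$ for $i\ge 2$. In the source the bound is expressed by saying that the class is ''$\{c,k,p\}$-bounded'', meaning bounded above by some function depending only on $c$, $k$ and $p$. *)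

(* Defs.v *)
From mathcomp Require Import all_boot all_fingroup all_solvable.

Set Implicit Arguments.
Unset Strict Implicit.
Unset Printing Implicit Defensive.

(* Main.v *)
Require Import Defs.
From mathcomp Require Import all_boot all_fingroup all_solvable.
From mathcomp Require Import all_algebra zify ring.

(* Write m = k - 2 and let B range over the subgroups of index at most p in A.  Special subgroups
   of weight 1 are the C_G(B), and those of weight n + 1 are the [J, C_G(B)] :&: C_G(B') with J
   special of weight n.  Since A-invariant subgroups are generated by their centralizers of the
   B's, 'L_m(G) is generated by the special subgroups H of weight m.  Such an H lies in some C_G(B)
   and in 'L_m(C_G(D)) with D of rank at least 2; as D meets every B, the hypothesis applies to H
   and any C_G(B) together.  The q-parts of the H generate a normal q-subgroup, so K := 'L_m(G) is
   nilpotent, and the image V of H in the Lie ring of K satisfies [K, V, ..., V] = 0 with c + 1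
   factors V.  The brackets of these boundedly many V are again spanned by subgroups of the V.
   Collecting words in the V shows that a soluble subring spanned by such pieces acts nilpotently,
   with bounds: this applies first to the centralizer of any a in A^#, which is soluble, then, by
   Kreknin's theorem for the Z/p-grading defined by a, to the whole Lie ring.  Everything is
   expressed by inclusions between spans of brackets, hence the lattice-theoretic setting. *)

Set Implicit Arguments.
Unset Strict Implicit.
Unset Printing Implicit Defensive.
Import GRing.Theory FiniteModule.

(** * Generation by centralizers in coprime action *)

Section AbelianGeneration.

Local Open Scope group_scope.

Variable gT : finGroupType.
Implicit Types (A V : {group gT}).

Lemma expg_Fp (p : nat) (x : gT) : prime p -> x ^+ p = 1 ->
  forall i j : 'F_p, (x ^+ (i + j)%R = x ^+ i * x ^+ j)
                  /\ (x ^+ (i * j)%R = x ^+ (i * j)%N).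
Proof.
move=> pr_p xp1 i j; have xF : x ^+ (Zp_trunc (pdiv p)).+2 = 1 by rewrite Fp_cast.
by rewrite -expgD /= !expg_mod.
Qed.

Lemma cent1_trace (p : nat) V x (cVV : abelian V) (v : fmod_of cVV) :
    prime p -> x ^+ p = 1 -> x \in 'N(V) ->
  val (\sum_(i : 'F_p) actr v (x ^+ i))%R \in 'C_V[x].
Proof.
move=> pr_p xp1 nVx; rewrite inE fmodP; apply/cent1P/commgP.
rewrite commgEl -eq_mulVg1 -fmvalJ // eq_sym; apply/eqP; congr (val _).
rewrite actr_sum [RHS](reindex_inj (addIr (1 : 'F_p)%R)); apply: eq_bigr => i _.
rewrite (expg_Fp pr_p xp1 _ _).1 actrM ?groupX //. 
Qed.

(** Additively, the conjugates of [v] by all [y ^+ j * x ^+ (i * j)] add up to the sum of the traces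
    over the [y * x ^+ i]. The terms with [j = 0] give [p] times [v]; those with a fixed [j != 0]
    give the trace over [x] moved by [y ^+ j], which [x] still centralizes. *)
Lemma abelem_line_trace (p : nat) A V x y v :
    prime p -> p.-abelem A -> abelian V -> A \subset 'N(V) ->
    x \in A -> y \in A -> v \in V ->
  v ^+ p \in << 'C_V[x] :|: \bigcup_(i : 'F_p) 'C_V[y * x ^+ i] >>.
Proof.
move=> pr_p abelA cVV nVA Ax Ay Vv.
set W := << _ >>.
have [cAA expA] : abelian A /\ {in A, forall z, z ^+ p = 1}.
  by case/(abelemP pr_p): abelA.
have nV z : z \in A -> z \in 'N(V) by apply: subsetP.
pose u : fmod_of cVV := fmod cVV v.
pose T z := (\sum_(i : 'F_p) actr u (z ^+ i))%R.
pose S (j : 'F_p) := actr (T x) (y ^+ j).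
have TW i : val (T (y * x ^+ i)) \in W.
  apply/mem_gen/setUP; right; apply/bigcupP; exists (inZp i) => //=.
  have Fi : (i %% (Zp_trunc (pdiv p)).+2 = i %% p)%N by rewrite Fp_cast.
  by rewrite Fi expg_mod ?expA // cent1_trace ?expA ?nV ?groupM ?groupX.
have SW j : val (S j) \in W.
  apply/mem_gen/setUP; left; rewrite fmvalJ ?nV ?groupX //.
  have /setIP[VT cxT] := cent1_trace u pr_p (expA x Ax) (nV x Ax).
  rewrite inE memJ_norm ?nV ?groupX ?VT //=.
  have cx : x ^ (y ^+ j) = x.
    by apply/conjg_fixP/commgP/commuteX; apply: (centsP cAA).
  by rewrite -[X in 'C[X]]cx cent1J memJ_conjg.
have def_pu : (u *+ p = \sum_(i : 'F_p) T (y * x ^+ i)%g - \sum_(j : 'F_p | j != 0) S j)%R.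
  have -> : (\sum_(i : 'F_p) T (y * x ^+ i)%g =
             \sum_(j : 'F_p) \sum_(i : 'F_p) actr u (y ^+ j * x ^+ (i * j)%R)%g)%R.
    rewrite exchange_big; apply: eq_bigr => i _; apply: eq_bigr => j _.
    rewrite (expg_Fp pr_p (expA x Ax) _ _).2 expgMn ?expgM //.
    by apply: commuteX; apply: (centsP cAA).
  rewrite (bigD1 0%R) // -addrA -sumrB [X in (_ + X)%R]big1 => [|j nz_j].
    rewrite (eq_bigr (fun=> u)) => [|i _]; last by rewrite mulr0 mulg1 actr1.
    by rewrite addr0 sumr_const cardT -cardE card_Fp.
  rewrite (reindex_inj (mulIf (invr_neq0 nz_j))) /S actr_sum -sumrB big1 // => i _.
  by rewrite divfK // -actrM ?groupX ?nV // (centsP cAA) ?groupX ?subrr.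
rewrite -(fmodK cVV Vv) -fmvalZ def_pu fmvalA fmvalN.
have sumW (I : finType) (P : pred I) (F : I -> fmod_of cVV) :
    (forall i, P i -> val (F i) \in W) -> val (\sum_(i | P i) F i)%R \in W.
  by move=> WF; elim/big_rec: _ => [|i w Pi Ww]; rewrite ?group1 // fmvalA groupM ?WF.
by rewrite groupM ?groupV ?sumW.
Qed.

Definition large_subgroups (p : nat) A : {set {group gT}} :=
  [set B : {group gT} | (B \subset A) && (#|A| <= #|B| * p)%N].

(** Induction on [#|A|]. For [z] in [A^#], a complement of [<[z]>] acts on ['C_V[z]], and joining
    [<[z]>] to its large subgroups gives large subgroups of [A]. If [#|A|] exceeds [p], line traces
    express [p]-th powers through these ['C_V[z]]. *)
Lemma abelian_gen_cent_large (p : nat) A V :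
    prime p -> p.-abelem A -> abelian V -> p^'.-group V -> A \subset 'N(V) ->
  V \subset << \bigcup_(B in large_subgroups p A) 'C_V(B) >>.
Proof.
move=> pr_p; have [n] := ubnP #|A|.
elim: n => // n IHn in A V * => /ltnSE-leAn abelA cVV p'V nVA.
have [pA [cAA _]] := (abelem_pgroup abelA, abelemP pr_p abelA).
set W := << _ >>; have [leAp | ltpA] := leqP #|A| p.
  rewrite sub_gen // (bigcup_max 1%G) ?inE ?sub1G ?cards1 ?mul1n //=.
  by rewrite subsetI subxx cents1.
have sCW z : z \in A^# -> 'C_V[z] \subset W.
  case/setD1P=> ntz Az; have oz := abelem_order_p abelA Az ntz.
  have sZA : <[z]> \subset A by rewrite cycle_subG.
  have /splitsP[B /complP[tiZB defA]] := abelem_splits abelA sZA.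
  have sBA : B \subset A by rewrite -defA mulG_subr.
  have oA : #|A| = (p * #|B|)%N by rewrite -defA TI_cardMg // -orderE oz.
  have nVzB : B \subset 'N('C_V[z]).
    rewrite normsI ?(subset_trans sBA) // (subset_trans _ (normG _)) //.
    by rewrite sub_cent1 (subsetP cAA).
  have ltBn : #|B| < n by rewrite (leq_trans _ leAn) // oA ltn_Pmull ?prime_gt1.
  have := IHn B ('C_V[z])%G ltBn (abelemS sBA abelA).
  move=> /(_ (abelianS (subsetIl _ _) cVV) (pgroupS (subsetIl _ _) p'V) nVzB).
  move/subset_trans; apply; rewrite gen_subG; apply/bigcupsP=> D.
  rewrite inE => /andP[sDB leBD]; rewrite sub_gen //.
  have tiZD : <[z]> :&: D = 1 by apply/trivgP; rewrite -tiZB setIS.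
  have cZD : D \subset 'C(<[z]>) by rewrite (sub_abelian_cent2 cAA) ?(subset_trans sDB).
  have oZD : #|<[z]> <*> D| = (p * #|D|)%N.
    by rewrite cent_joinEr ?TI_cardMg // -orderE oz.
  rewrite (bigcup_max (<[z]> <*> D)%G) //.
    rewrite inE join_subG sZA (subset_trans sDB) //= oZD oA -mulnA leq_mul2l.
    by rewrite leBD orbT.
  by rewrite /= -setIA setIS // -cent_cycle centY.
have [x /setD1P[ntx Ax]] : exists x, x \in A^#.
  apply/set0Pn; rewrite setD_eq0 subG1 -cardG_gt1.
  exact: leq_trans (prime_gt1 pr_p) (ltnW ltpA).
have ox := abelem_order_p abelA Ax ntx.
have [y Ay Xy] : exists2 y, y \in A & y \notin <[x]>.
  apply/subsetPn; apply: contraL ltpA => /subset_leq_card.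
  by rewrite -leqNgt -orderE ox.
(* As [#|V|] is prime to [p], [v] is itself a power of [v ^+ p]. *)
apply/subsetP=> v Vv; have co_p : coprime #|V| p by rewrite coprime_sym prime_coprime // -p'natE.
rewrite -(expgK co_p Vv) groupX //.
apply: subsetP (abelem_line_trace pr_p abelA cVV nVA Ax Ay Vv).
rewrite gen_subG subUset sCW ?inE ?ntx //=; apply/bigcupsP=> i _; apply: sCW.
rewrite !inE groupM ?groupX // andbT; apply: contra Xy => /eqP yx1.
by rewrite -(mulgK (x ^+ i) y) yx1 mul1g groupV mem_cycle.
Qed.

End AbelianGeneration.

(** * From abelian groups to arbitrary p'-groups *)

Section CoprimeGeneration.

Local Open Scope group_scope.

Variable gT : finGroupType.
Implicit Types (A Q X : {group gT}).

Lemma pgroup_gen_cent_large (p q : nat) A Q :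
    prime p -> p.-abelem A -> q.-group Q -> p^'.-group Q -> A \subset 'N(Q) ->
  Q \subset << \bigcup_(B in large_subgroups p A) 'C_Q(B) >>.
Proof.
move=> pr_p abelA qQ p'Q nQA; set W := << _ >>.
have pA := abelem_pgroup abelA; have coQA := p'nat_coprime p'Q pA.
have solQ := pgroup_sol qQ; have sPhiQ := Phi_sub Q.
have nPhiA : A \subset 'N('Phi(Q)) := char_norm_trans (Phi_char Q) nQA.
have nPhiQ : Q \subset 'N('Phi(Q)) := normal_norm (Phi_normal Q).
have sWQ : W \subset Q by rewrite gen_subG; apply/bigcupsP=> B _; apply: subsetIl.
have sQWPhi : Q \subset <<'Phi(Q) :|: W>>; last first.
  suff {1}<- : <<W>> = Q by rewrite genGid.
  by apply: Phi_nongen; apply/eqP; rewrite eqEsubset sQWPhi gen_subG subUset sPhiQ sWQ.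
have cQQ : abelian (Q / 'Phi(Q)) := abelem_abelian (Phi_quotient_abelem qQ).
have abelAq : p.-abelem (A / 'Phi(Q)) by apply: quotient_abelem.
have tiAPhi : A :&: 'Phi(Q) = 1.
  by rewrite setIC coprime_TIg // (coprimeSg sPhiQ).
have oAq : #|A / 'Phi(Q)| = #|A|.
  by rewrite card_quotient // -indexgI tiAPhi indexg1.
have := abelian_gen_cent_large pr_p abelAq cQQ (quotient_pgroup _ p'Q) (quotient_norms _ nQA).
rewrite -(quotientSGK nPhiQ (joing_subl _ _)) => /subset_trans-> //.
rewrite gen_subG; apply/bigcupsP=> Bq /[!inE] /andP[sBqA leBq].
(* [A] meets ['Phi(Q)] trivially, so the part of the preimage of [Bq] inside [A] is again large. *)
pose B := (A :&: coset 'Phi(Q) @*^-1 Bq)%G.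
have sBA : B \subset A := subsetIl _ _.
have defBq : Bq :=: B / 'Phi(Q) by rewrite /quotient morphim_setIpre (setIidPr _).
rewrite defBq -coprime_quotient_cent ?(subset_trans sBA) ?(coprimegS sBA) //.
rewrite quotientS // sub_gen // subsetU // orbC sub_gen // (bigcup_max B) //.
rewrite inE sBA -oAq (leq_trans leBq) // leq_mul2r defBq leq_quotient orbT //.
Qed.

(** For every prime [q] the left side contains an [A]-invariant Sylow [q]-subgroup of [X]. *)
Lemma coprime_gen_cent_large (p : nat) A X :
    prime p -> p.-abelem A -> p^'.-group X -> A \subset 'N(X) ->
  << \bigcup_(B in large_subgroups p A) 'C_X(B) >> = X.
Proof.
move=> pr_p abelA p'X nXA; set W := << _ >>.
have pA := abelem_pgroup abelA; have coXA := p'nat_coprime p'X pA.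
have sWX : W \subset X by rewrite gen_subG; apply/bigcupsP=> B _; apply: subsetIl.
apply/eqP; rewrite eqEcard sWX dvdn_leq ?cardG_gt0 //.
apply/dvdn_partP=> // q; rewrite mem_primes => /and3P[pr_q _ _].
have [Q sylQ nQA] := sol_coprime_Sylow_exists q (pgroup_sol pA) nXA coXA.
have [sQX qQ _] := and3P sylQ; rewrite -(card_Hall sylQ) cardSg //.
apply: subset_trans (pgroup_gen_cent_large pr_p abelA qQ (pgroupS sQX p'X) nQA) _.
by rewrite genS //; apply/bigcupsP=> B ?; rewrite (bigcup_max B) // setSI.
Qed.

End CoprimeGeneration.

(** * Special subgroups *)

Section SpecialSubgroups.

Local Open Scope group_scope.

Lemma commG_gen_sub (gT : finGroupType) (X Y : {set gT}) (W : {group gT}) :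
    X \subset 'N(W) -> Y \subset 'N(W) ->
    (forall x y, x \in X -> y \in Y -> [~ x, y] \in W) ->
  [~: <<X>>, <<Y>>] \subset W.
Proof.
move=> nWX nWY sXYW; rewrite -quotient_cents2 ?gen_subG // (quotient_gen nWX) (quotient_gen nWY).
rewrite gen_subG /= cent_gen quotient_cents2r // gen_subG.
by apply/subsetP=> _ /imset2P[x y Xx Yy ->]; apply: sXYW.
Qed.

Variables (gT : finGroupType) (p : nat) (A G : {group gT}).
Hypotheses (pr_p : prime p) (abelA : p.-abelem A) (p'G : p^'.-group G).
Hypothesis nGA : A \subset 'N(G).
Implicit Types (B D H J X : {group gT}).

Local Notation hs := (large_subgroups p A).

(** Mind the shift: [specials n] lists the special subgroups of weight [n + 1]. *)
Fixpoint specials (n : nat) : seq {group gT} :=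
  if n is n'.+1 then
    [seq ([~: J, 'C_G(BB.1)] :&: 'C_G(BB.2))%G
       | J <- specials n', BB : {group gT} * {group gT} <- enum (setX hs hs)]
  else [seq 'C_G(B)%G | B : {group gT} <- enum hs].

Let subG_gen X : X \subset G -> A \subset 'N(X) ->
  << \bigcup_(B in hs) 'C_X(B) >> = X.
Proof.
by move=> sXG nXA; rewrite coprime_gen_cent_large // (pgroupS sXG).
Qed.

Lemma special_S n J B1 B2 :
    J \in specials n -> B1 \in hs -> B2 \in hs ->
  ([~: J, 'C_G(B1)] :&: 'C_G(B2))%G \in specials n.+1.
Proof.
move=> nJ hB1 hB2; apply/allpairsP; exists (J, (B1, B2)).
by rewrite nJ mem_enum in_setX hB1 hB2.
Qed.

Lemma specialSP n H : H \in specials n.+1 ->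
  exists J B1 B2, [/\ J \in specials n, B1 \in hs, B2 \in hs
                   & H = ([~: J, 'C_G(B1)] :&: 'C_G(B2))%G].
Proof.
case/allpairsP=> [[J [B1 B2]] /= []]; rewrite mem_enum in_setX => nJ.
by case/andP=> hB1 hB2 ->; exists J, B1, B2.
Qed.

Lemma special_mono n H : H \in specials n.+1 ->
  exists2 J, J \in specials n & H \subset J.
Proof.
elim: n H => [|n IHn] H /specialSP[J [B1 [B2 [nJ hB1 hB2 ->]]]].
  exists 'C_G(B2)%G; last exact: subsetIr.
  by apply/mapP; exists B2; rewrite ?mem_enum.
have [J' nJ' sJJ'] := IHn J nJ.
by exists ([~: J', 'C_G(B1)] :&: 'C_G(B2))%G; rewrite ?special_S // setSI ?commSg.
Qed.

Lemma special_cent n H : H \in specials n -> exists2 B, B \in hs & H \subset 'C_G(B).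
Proof.
case: n => [/mapP[B]|n /specialSP[J [B1 [B2 [nJ hB1 hB2 ->]]]]].
  by rewrite mem_enum => hB ->; exists B.
by exists B2; rewrite ?subsetIr.
Qed.

Lemma special_subG n H : H \in specials n -> H \subset G.
Proof. by case/special_cent=> B _ /subset_trans-> //; apply: subsetIl. Qed.

Lemma cent_large_norm B : B \in hs -> A \subset 'N('C_G(B)).
Proof.
rewrite inE => /andP[sBA _]; rewrite normsI // (subset_trans _ (normG _)) //.
exact: subset_trans (abelem_abelian abelA) (centS sBA).
Qed.

Lemma special_norm n H : H \in specials n -> A \subset 'N(H).
Proof.
elim: n H => [|n IHn] H.
  by case/mapP=> B; rewrite mem_enum => /cent_large_norm nCB ->.
case/specialSP=> J [B1 [B2 [nJ hB1 hB2 ->]]].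
by apply: normsI (normsR (IHn _ nJ) (cent_large_norm hB1)) (cent_large_norm hB2).
Qed.

(* Each commutator with some C_G(B) replaces D by D :&: B, which multiplies its index by at most p. *)
Lemma special_lcn n H : H \in specials n ->
  exists D, [/\ D \subset A, #|A| <= #|D| * p ^ n.+1 & H \subset 'L_n.+1('C_G(D))].
Proof.
elim: n H => [|n IHn] H.
  case/mapP=> B; rewrite mem_enum inE => /andP[sBA leB] ->.
  by exists B; rewrite expn1.
case/specialSP=> J [B1 [B2 [nJ]]]; rewrite !inE => /andP[sB1A leB1] _ ->.
have [D [sDA leD sJD]] := IHn J nJ; exists (D :&: B1)%G; split.
- by rewrite subIset ?sDA.
- have leDB : #|D| * #|B1| <= #|A| * #|D :&: B1|.
    by rewrite mul_cardG leq_mul2r subset_leq_card ?orbT // mul_subG.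
  rewrite -(leq_pmul2l (cardG_gt0 A)) /= mulnA.
  apply: leq_trans (leq_mul leDB (leqnn (p ^ n.+2))).
  by rewrite expnSr mulnACA leq_mul.
rewrite (subset_trans (subsetIl _ _)) //= lcnSn commgSS //.
  by rewrite (subset_trans sJD) // lcnS // setIS // centS // subsetIl.
by rewrite setIS // centS // subsetIr.
Qed.

(** The commutator is [A]-invariant, hence generated by its centralizers of the large subgroups,
    each of which lies in a special subgroup of the next weight. *)
Lemma special_commS n J B :
    J \in specials n -> B \in hs ->
  [~: J, 'C_G(B)] \subset << \bigcup_(H in specials n.+1) H >>.
Proof.
move=> nJ hB; have sJG := special_subG nJ.
have nXA : A \subset 'N([~: J, 'C_G(B)]) := normsR (special_norm nJ) (cent_large_norm hB).
have sXG : [~: J, 'C_G(B)] \subset G by rewrite comm_subG ?subsetIl.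
rewrite -{1}(subG_gen sXG nXA) genS //; apply/bigcupsP=> B' hB'.
rewrite (bigcup_max ([~: J, 'C_G(B)] :&: 'C_G(B'))%G) ?special_S //=.
by rewrite subsetI subsetIl setSI // comm_subG ?subsetIl.
Qed.

Lemma special_gen_mono n :
  << \bigcup_(H in specials n.+1) H >> \subset << \bigcup_(H in specials n) H >>.
Proof.
rewrite genS //; apply/bigcupsP=> H /special_mono[J nJ sHJ].
by rewrite (bigcup_max J).
Qed.

Let genCG : << \bigcup_(H in specials 0) H >> = G.
Proof.
rewrite -[RHS]subG_gen //; congr << _ >>; apply/eqP; rewrite eqEsubset.
apply/andP; split; apply/bigcupsP.
  by move=> H /mapP[B]; rewrite mem_enum => hB ->; rewrite (bigcup_max B).
by move=> B hB; rewrite (bigcup_max 'C_G(B)%G) //; apply/mapP; exists B; rewrite ?mem_enum.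
Qed.

(** For [x] in some ['C_G(B)], [y ^ x] is [y * [~ y, x]], and the commutator falls into the span of
    the next weight, which is contained in this one. *)
Lemma special_gen_norm n : G \subset 'N(<< \bigcup_(H in specials n) H >>).
Proof.
rewrite -{1}genCG gen_subG; apply/bigcupsP=> C /mapP[B]; rewrite mem_enum => hB ->.
apply/subsetP=> x Cx; rewrite inE -genJ gen_subG.
apply/subsetP=> _ /imsetP[y /bigcupP[J nJ Jy] ->].
rewrite conjg_mulR groupM //; first by rewrite mem_gen //; apply/bigcupP; exists J.
apply: (subsetP (special_gen_mono n)).
by apply: (subsetP (special_commS nJ hB)); rewrite mem_commg.
Qed.

Lemma special_gen n : << \bigcup_(H in specials n) H >> = 'L_n.+1(G).
Proof.
elim: n => [|n IHn]; first exact: genCG.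
apply/eqP; rewrite eqEsubset gen_subG [gval _]lcnSn lcnSn -IHn; apply/andP; split.
  apply/bigcupsP=> H /specialSP[J [B1 [B2 [nJ hB1 hB2 ->]]]].
  apply: subset_trans (subsetIl _ _) (commgSS _ (subsetIl _ _)).
  by rewrite sub_gen // (bigcup_max J).
set W := << \bigcup_(H in specials n.+1) H >>.
have nWG := special_gen_norm n.+1; rewrite -/W in nWG.
have sWG : W \subset G.
  by rewrite gen_subG; apply/bigcupsP=> H /special_subG.
rewrite -{1}genCG; apply: commG_gen_sub => [||x y].
- by apply/bigcupsP=> J /special_subG/subset_trans->.
- by apply/bigcupsP=> J /special_subG/subset_trans->.
case/bigcupP=> J nJ Jx /bigcupP[C /mapP[B]]; rewrite mem_enum => hB -> Cy.
by apply: (subsetP (special_commS nJ hB)); rewrite mem_commg.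
Qed.

(** A special subgroup of weight [n + 1] is determined by [2n + 1] choices of a subgroup of [A]. *)
Lemma size_special n : (size (specials n) <= (2 ^ #|A|) ^ n.*2.+1)%N.
Proof.
have leh : (#|hs| <= 2 ^ #|A|)%N.
  rewrite -card_powerset -(card_imset _ (@group_inj gT)).
  apply/subset_leq_card/subsetP=> _ /imsetP[B /[!inE] /andP[sBA _] ->].
  by [].
elim: n => [|n IHn] /=; first by rewrite size_map -cardE expn1.
rewrite size_allpairs -cardE cardsX doubleS.
by rewrite [X in (_ <= X)%N]expnSr expnSr -mulnA !leq_mul.
Qed.

End SpecialSubgroups.

(** * Nilpotency *)

Section Nilpotency.

Local Open Scope group_scope.

Variables (gT : finGroupType) (p n : nat) (A G : {group gT}).
Hypotheses (pr_p : prime p) (abelA : p.-abelem A) (p'G : p^'.-group G).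
Hypothesis nGA : A \subset 'N(G).
Hypothesis ltpA : (p ^ n.+2 < #|A|)%N.
Implicit Types (B D H J X : {group gT}).

Local Notation hs := (large_subgroups p A).
Local Notation specials := (specials p A G).

(** [D] has index at most [p ^ n.+1] and [B] at most [p], so [D :&: B] is nontrivial. An [a] in it
    puts both [H] and ['C_G(B)] inside ['C_G[a]], where the hypothesis on centralizers applies. *)
Lemma special_meet H B : H \in specials n -> B \in hs ->
  exists a, [/\ a \in A^#, a \in B & H \subset 'L_n.+1('C_G[a])].
Proof.
move=> nH; rewrite inE => /andP[sBA leB].
have [D [sDA leD sHD]] := special_lcn nH.
have ltDB : 1 < #|D :&: B|.
  rewrite ltnNge; apply: contraL ltpA => le1; rewrite -leqNgt.
  rewrite -(leq_pmul2l (cardG_gt0 A)); apply: leq_trans (leq_mul leD leB) _.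
  rewrite mulnACA -expnSr leq_mul //; apply: leq_trans (_ : _ <= #|A| * #|D :&: B|)%N _.
    by rewrite mul_cardG leq_mul2r subset_leq_card ?orbT // mul_subG.
  by rewrite -[leqRHS]muln1 leq_mul.
have /trivgPn[a /setIP[Da Ba] nta] : (D :&: B)%G :!=: 1 by rewrite -cardG_gt1.
exists a; rewrite !inE nta (subsetP sDA) //; split=> //.
by rewrite (subset_trans sHD) // lcnS // setIS // -cent_set1 centS ?sub1set.
Qed.

Hypothesis nilC : {in A^#, forall a, nilpotent 'L_n.+1('C_G[a])}.

Lemma special_nil H : H \in specials n -> nilpotent H.
Proof.
move=> nH; have hA : A \in hs by rewrite inE subxx leq_pmulr ?prime_gt0.
have [a [Aa _ sHT]] := special_meet nH hA.
exact: nilpotentS sHT (nilC Aa).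
Qed.

Lemma special_pcore (q : nat) H B : H \in specials n -> B \in hs ->
  exists a, [/\ a \in A^#, a \in B & 'O_q(H) \subset 'O_q('C_G[a])].
Proof.
move=> nH hB; have [a [Aa Ba sHT]] := special_meet nH hB.
exists a; split=> //; set T := 'L_n.+1('C_G[a]) in sHT.
have sHqT : 'O_q(H) \subset 'O_q(T).
  have hallT := nilpotent_pcore_Hall q (nilC Aa).
  by rewrite (sub_Hall_pcore hallT) ?pcore_pgroup // (subset_trans (pcore_sub _ _)).
apply: subset_trans sHqT (pcore_max (pcore_pgroup _ _) _).
by rewrite (char_normal_trans (pcore_char _ _)) ?lcn_normal.
Qed.

Definition special_pcores (q : nat) := << \bigcup_(H in specials n) 'O_q(H) >>.

(** ['C_G(B)] normalizes ['O_q('C_G[a])], which contains ['O_q(H)], so the commutator is a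
    [q]-group. It is also [A]-invariant, and its pieces lie in nilpotent special subgroups, hence in
    their [q]-cores. *)
Lemma special_pcores_comm (q : nat) H B : H \in specials n -> B \in hs ->
  [~: 'O_q(H), 'C_G(B)] \subset special_pcores q.
Proof.
move=> nH hB; pose Y := [~: 'O_q(H), 'C_G(B)]%G; change (Y \subset special_pcores q).
have sHG := special_subG nH.
have [a [Aa Ba sHC]] := special_pcore q nH hB.
have sCBa : 'C_G(B) \subset 'C_G[a] by rewrite setIS // -cent_set1 centS ?sub1set.
have qY : q.-group Y.
  apply: pgroupS (pcore_pgroup q 'C_G[a]).
  rewrite (subset_trans (commSg _ sHC)) // commg_subl.
  by rewrite (subset_trans sCBa) // gFnorm.
have sYG : Y \subset G by rewrite comm_subG ?subsetIl // (subset_trans (pcore_sub _ _)).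
have nYA : A \subset 'N(Y).
  apply: normsR (cent_large_norm abelA nGA hB); apply: char_norm_trans (pcore_char _ _) _.
  exact: special_norm nH.
rewrite -(coprime_gen_cent_large pr_p abelA (pgroupS sYG p'G) nYA).
rewrite genS //; apply/bigcupsP=> B' hB'.
have [J nJ sHJ] := special_mono (special_S nH hB hB').
rewrite (bigcup_max J) // (sub_Hall_pcore (nilpotent_pcore_Hall q (special_nil nJ))).
  exact: pgroupS (subsetIl _ _) qY.
apply: subset_trans sHJ; rewrite subsetI setSI // andbT.
by rewrite (subset_trans (subsetIl _ _)) // commSg ?pcore_sub.
Qed.

Lemma special_pcores_norm (q : nat) : G \subset 'N(special_pcores q).
Proof.
rewrite -{1}(coprime_gen_cent_large pr_p abelA p'G nGA) gen_subG.
apply/bigcupsP=> B hB; apply/subsetP=> x Cx; rewrite inE -genJ gen_subG.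
apply/subsetP=> _ /imsetP[y /bigcupP[H nH Hy] ->].
rewrite conjg_mulR groupM //; first by rewrite mem_gen //; apply/bigcupP; exists H.
by apply: (subsetP (special_pcores_comm q nH hB)); rewrite mem_commg.
Qed.

Lemma special_pcores_sub (q : nat) : special_pcores q \subset G.
Proof.
rewrite gen_subG; apply/bigcupsP=> H nH; apply: subset_trans (pcore_sub _ _) _.
exact: special_subG nH.
Qed.

(* An A-invariant Sylow q-subgroup of G contains every O_q(C_G(a)), as the latter is centralized by a. *)
Lemma special_pcores_pgroup (q : nat) : q.-group (special_pcores q).
Proof.
have solA := pgroup_sol (abelem_pgroup abelA).
have coGA := p'nat_coprime p'G (abelem_pgroup abelA).
have [Q sylQ nQA] := sol_coprime_Sylow_exists q solA nGA coGA.
apply: pgroupS (pHall_pgroup sylQ); rewrite gen_subG; apply/bigcupsP=> H nH.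
have hA : A \in hs by rewrite inE subxx leq_pmulr ?prime_gt0.
have [a [/setD1P[_ Aa] _ /subset_trans-> //]] := special_pcore q nH hA.
have sZA : <[a]> \subset A by rewrite cycle_subG.
have [nGZ coGZ] := (subset_trans sZA nGA, coprimegS sZA coGA).
have sCG : 'O_q('C_G[a]) \subset G by rewrite (subset_trans (pcore_sub _ _)) ?subsetIl.
have cZC : 'O_q('C_G[a]) \subset 'C(<[a]>).
  by rewrite (subset_trans (pcore_sub _ _)) // cent_cycle subsetIr.
have nCZ : <[a]> \subset 'N('O_q('C_G[a])) by rewrite cents_norm // centsC.
have [P [sylP nPZ sCP]] := sol_coprime_Sylow_subset nGZ coGZ (solvableS sZA solA)
  sCG (pcore_pgroup _ _) nCZ.
(* [P] and [Q] are conjugate under ['C_G[a]], which normalizes its own [q]-core, so the core lies in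
   [Q] as well. *)
have := atransP2 (sol_coprime_Sylow_trans q (solvableS sZA solA) nGZ coGZ).
move=> /(_ P Q); rewrite !inE sylP sylQ nPZ (subset_trans sZA nQA) /=.
move=> /(_ isT isT)[g]; rewrite cent_cycle => Cg ->; rewrite /= -sub_conjgV.
have nCg : g^-1 \in 'N('O_q('C_G[a])) by apply: subsetP (groupVr Cg); apply: gFnorm.
by rewrite (normP nCg).
Qed.

(** Each Sylow subgroup of each special subgroup lies in some normal [q]-subgroup [special_pcores q]
    of [G], hence in the Fitting subgroup. *)
Lemma nilpotent_lcn_of_cent : nilpotent 'L_n.+1(G).
Proof.
apply: nilpotentS (Fitting_nil G); rewrite -(special_gen pr_p abelA p'G nGA) gen_subG.
apply/bigcupsP=> H nH; rewrite -(Sylow_gen H) gen_subG.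
apply/bigcupsP=> Q /SylowP[q _ sylQ].
rewrite (nilpotent_Hall_pcore (special_nil nH) sylQ).
apply: subset_trans (Fitting_max (H := special_pcores q) _ (pgroup_nil (special_pcores_pgroup q))).
  by rewrite sub_gen // (bigcup_max H).
by rewrite /normal special_pcores_sub special_pcores_norm.
Qed.

End Nilpotency.

(** * Lattices of additive subgroups of Lie rings *)

(* The additive subgroups of a Lie ring, with [lmul] the span of all brackets; [lle] is only a
   preorder, as additive subgroups are represented by sets of generators. *)
Record lie_lattice := LieLattice {
  ll_car :> Type;
  lle : ll_car -> ll_car -> Prop;
  lsup : (ll_car -> Prop) -> ll_car;
  lmul : ll_car -> ll_car -> ll_car;
  lle_refl : forall x, lle x x;
  lle_trans : forall y x z, lle x y -> lle y z -> lle x z;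
  lsup_ub : forall (P : ll_car -> Prop) x, P x -> lle x (lsup P);
  lsup_lub : forall (P : ll_car -> Prop) y, (forall x, P x -> lle x y) -> lle (lsup P) y;
  lmulC : forall x y, lle (lmul x y) (lmul y x);
  lmul_monol : forall x x' y, lle x x' -> lle (lmul x y) (lmul x' y);
  lmul_supl : forall (P : ll_car -> Prop) y z,
    (forall x, P x -> lle (lmul x y) z) -> lle (lmul (lsup P) y) z;
  ljacobi : forall x y z w,
    lle (lmul (lmul x z) y) w -> lle (lmul x (lmul y z)) w -> lle (lmul (lmul x y) z) w
}.

Section LieLattice.

Variable L : lie_lattice.
Implicit Types (x y z T F M : L).

Local Notation "x <=' y" := (lle x y) (at level 70).
Local Notation "x *' y" := (lmul x y) (at level 40, left associativity).

Definition lbot : L := lsup (fun=> False).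
Definition ljoin x y : L := lsup (fun z => z = x \/ z = y).
Definition lact x y (n : nat) : L := iter n (fun z => z *' y) x.

Lemma lbot_le x : lbot <=' x.
Proof. by apply: lsup_lub. Qed.

Lemma ljoin_lub x y z : x <=' z -> y <=' z -> ljoin x y <=' z.
Proof. by move=> xz yz; apply: lsup_lub => _ [->|->]. Qed.

Lemma lle_joinl x y z : z <=' x -> z <=' ljoin x y.
Proof. by move/lle_trans; apply; apply: lsup_ub; left. Qed.

Lemma lle_joinr x y z : z <=' y -> z <=' ljoin x y.
Proof. by move/lle_trans; apply; apply: lsup_ub; right. Qed.

Lemma lmul_monor x y y' : y <=' y' -> x *' y <=' x *' y'.
Proof.
by move=> yy'; apply: lle_trans (lmulC _ _) (lle_trans (lmul_monol _ yy') (lmulC _ _)).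
Qed.

Lemma lmul_mono x x' y y' : x <=' x' -> y <=' y' -> x *' y <=' x' *' y'.
Proof. by move=> xx' yy'; apply: lle_trans (lmul_monol y xx') (lmul_monor x' yy'). Qed.

Lemma lmul_supr (P : L -> Prop) x z :
  (forall y, P y -> x *' y <=' z) -> x *' lsup P <=' z.
Proof.
move=> Pz; apply: lle_trans (lmulC _ _) (lmul_supl _) => y Py.
exact: lle_trans (lmulC _ _) (Pz y Py).
Qed.

Lemma lmul_joinl x y z w : x *' z <=' w -> y *' z <=' w -> ljoin x y *' z <=' w.
Proof. by move=> xz yz; apply: lmul_supl => _ [->|->]. Qed.

Lemma lmul_botl x y : lbot *' x <=' y.
Proof. exact: lmul_supl. Qed.

Lemma lmul_botr x y : x *' lbot <=' y.
Proof. exact: lmul_supr. Qed.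

Lemma lmul_le_bot x y z : x <=' lbot -> x *' y <=' z.
Proof. by move/lmul_monol/lle_trans; apply; apply: lmul_botl. Qed.

Lemma lmulr_le_bot x y z : y <=' lbot -> x *' y <=' z.
Proof. by move/lmul_monor/lle_trans; apply; apply: lmul_botr. Qed.

Lemma ljacobir x y z w :
  x *' y *' z <=' w -> x *' z *' y <=' w -> x *' (y *' z) <=' w.
Proof.
move=> xyz xzy; apply: lle_trans (lmulC _ _) (ljacobi _ _).
  exact: lle_trans (lmul_monol _ (lmulC _ _)) xyz.
apply: lle_trans (lmulC _ _) _.
exact: lle_trans (lmul_monol _ (lmulC _ _)) xzy.
Qed.

Lemma lact_mono x x' y y' n : x <=' x' -> y <=' y' -> lact x y n <=' lact x' y' n.
Proof.
move=> xx' yy'; elim: n => // n IHn.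
exact: lmul_mono.
Qed.

Lemma lact_bot x y n : x <=' lbot -> lact x y n <=' lbot.
Proof. by move=> x0; elim: n => // n IHn; apply: lmul_le_bot. Qed.

Lemma lact_sup (P : L -> Prop) y z n :
  (forall x, P x -> lact x y n <=' z) -> lact (lsup P) y n <=' z.
Proof.
elim: n P => [|n IHn] P Pz; first exact: lsup_lub.
pose Q u := exists2 x, P x & u = x *' y.
rewrite /lact iterSr; apply: lle_trans (IHn Q _) => [|_ [x Px ->]].
  by apply: lact_mono (lle_refl _); apply: lmul_supl => x Px; apply: lsup_ub; exists x.
by rewrite /lact -iterSr; apply: Pz.
Qed.

(** Each of the [d] levels of a chain multiplies the number of factors by [b * c + 1], the length at
    which one of [b] letters must occur more than [c] times. *)
Definition engel_bound (b c d : nat) := (b * c).+1 ^ d.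

(** * Collecting words: an Engel-type bound *)

Section Engel.

Variables (I : eqType) (s : seq I) (c : nat) (T : L).

Definition lsums (U : I -> L) : L := lsup (fun x => exists2 i, i \in s & x = U i).

Definition wact (U : I -> L) x (w : seq I) : L := foldl (fun z i => z *' U i) x w.

Lemma wact_mono U x y w : x <=' y -> wact U x w <=' wact U y w.
Proof. by elim: w x y => //= i w IHw x y xy; apply: IHw; apply: lmul_monol. Qed.

Lemma wact_sup U (P : L -> Prop) z w :
  (forall x, P x -> wact U x w <=' z) -> wact U (lsup P) w <=' z.
Proof.
elim: w P => [|i w IHw] P /= Pz; first exact: lsup_lub.
pose Q y := exists2 x, P x & y = x *' U i.
apply: lle_trans (IHw Q _) => [|y [x Px ->]]; last exact: Pz.
by apply: wact_mono; apply: lmul_supl => x Px; apply: lsup_ub; exists x.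
Qed.

Lemma lact_sums U x n z :
  (forall w, {subset w <= s} -> size w = n -> wact U x w <=' z) ->
  lact x (lsums U) n <=' z.
Proof.
elim: n x => [|n IHn] x xz; first exact: (xz [::]).
rewrite /lact iterSr; apply: IHn => w sws sz_w.
pose Q y := exists2 i, i \in s & y = x *' U i.
apply: lle_trans (wact_sup (P := Q) _) => [|y [i si ->]].
  apply: wact_mono; apply: lmul_supr => y [i si ->].
  by apply: lsup_ub; exists i.
apply: (xz (i :: w)) => [j|]; last by rewrite /= sz_w.
by rewrite inE => /predU1P[-> // | /sws].
Qed.

Lemma pigeonhole_seq (w : seq I) :
  {subset w <= s} -> size s * c < size w -> exists2 i, i \in s & c < count_mem i w.
Proof.
move=> sws sz_w; apply/hasP; apply: contraLR sz_w => /hasPn Hle; rewrite -leqNgt.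
have /eqP<- : count (mem s) w == size w by rewrite -all_count; apply/allP.
move: Hle; elim: (s) => [|i s' IHs'] Hle; first by rewrite count_pred0.
have {IHs'} IH := IHs' (fun j s'j => Hle j (mem_behead (s := i :: s') s'j)).
have le_iw : count_mem i w <= c by rewrite leqNgt Hle ?mem_head.
apply: leq_trans (leq_add le_iw IH); rewrite -count_predUI.
rewrite (eq_count (a2 := predU (pred1 i) (mem s'))) ?leq_addr //.
Qed.

(* Modulo [F *' M'] the factors [V i] acting on [F] commute. *)
Section Reorder.

Variables (V : I -> L) (F M' : L).
Hypothesis FV : forall i, i \in s -> F *' V i <=' F.
Hypothesis FM'V : forall i, i \in s -> F *' M' *' V i <=' F *' M'.
Hypothesis VV : forall i j, i \in s -> j \in s -> V i *' V j <=' M'.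

Let F' := F *' M'.

Lemma wact_ideal y w : {subset w <= s} -> y <=' F' -> wact V y w <=' F'.
Proof.
elim: w y => //= i w IHw y sws yF'; apply: IHw => [j wj|].
  by apply: sws; rewrite inE wj orbT.
by apply: lle_trans (lmul_monol _ yF') (FM'V _); rewrite sws ?mem_head.
Qed.

Lemma wact_join y z w x :
  wact V y w <=' x -> wact V z w <=' x -> wact V (ljoin y z) w <=' x.
Proof. by move=> yx zx; apply: wact_sup => _ [->|->]. Qed.

Lemma wact_rcons y w i : wact V y (rcons w i) = wact V y w *' V i.
Proof. by rewrite /wact -cats1 foldl_cat. Qed.

(** The last letter moves to the front by adjacent exchanges. By the Jacobi identity each costs a
    term in [F *' (V j *' V i)], which lies in [F'] and stays there under the remaining letters. *)
Lemma wact_swap y w i : y <=' F -> i \in s -> {subset w <= s} ->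
  wact V y (rcons w i) <=' ljoin (wact V (y *' V i) w) F'.
Proof.
move=> yF si; elim: w y yF => [|j w IHw] y yF sws; first exact: lle_joinl (lle_refl _).
have sj : j \in s by rewrite sws ?mem_head.
have {}sws : {subset w <= s} by move=> k wk; rewrite sws ?inE ?wk ?orbT.
have yVF : y *' V j <=' F by apply: lle_trans (lmul_monol _ yF) (FV sj).
apply: lle_trans (IHw _ yVF sws) (ljoin_lub _ (lle_joinr _ (lle_refl _))) => /=.
apply: (@lle_trans _ (wact V (ljoin (y *' V i *' V j) F') w)).
  apply: wact_mono; apply: ljacobi; first exact: lle_joinl (lle_refl _).
  by apply: lle_joinr; apply: lmul_mono yF (VV sj si).
apply: wact_join; first exact: lle_joinl (lle_refl _).
by apply: lle_joinr; apply: wact_ideal (lle_refl _).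
Qed.

Lemma lact_closed y i n : y <=' F -> i \in s -> lact y (V i) n <=' F.
Proof.
move=> yF si; elim: n => //= n IHn.
exact: lle_trans (lmul_monol _ IHn) (FV si).
Qed.

(** Scanning from the right end, each [i] met is moved in front of the other letters, next to the
    occurrences already collected. *)
Lemma wact_collect y w i : y <=' F -> i \in s -> {subset w <= s} ->
  wact V y w <=' ljoin (wact V (lact y (V i) (count_mem i w)) [seq j <- w | j != i]) F'.
Proof.
move=> yF si; elim/last_ind: w => [|w j IHw] sws; first exact: lle_joinl (lle_refl _).
have sj : j \in s by rewrite sws ?mem_rcons ?mem_head.
have {}sws : {subset w <= s} by move=> k wk; rewrite sws ?mem_rcons ?inE ?wk ?orbT.
have sfs : {subset [seq k <- w | k != i] <= s}.
  by move=> k; rewrite mem_filter => /andP[_]; apply: sws.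
rewrite wact_rcons; apply: lle_trans (lmul_monol _ (IHw sws)) _.
apply: lmul_joinl; last by apply: lle_joinr; apply: FM'V.
have -> : count_mem i (rcons w j) = count_mem i w + (j == i).
  by rewrite -cats1 count_cat /= addn0.
rewrite filter_rcons; case: (eqVneq j i) => [->|ne_ji] /=.
  rewrite addn1 -wact_rcons; apply: wact_swap => //.
  exact: lact_closed.
by rewrite addn0 wact_rcons; apply: lle_joinl (lle_refl _).
Qed.

End Reorder.

(* With M := lsums (Ve 0) and M' := lsums (Ve 1), each T M' ... M' is M-invariant.  Modulo its
   product with M', long words in the V i can be sorted, and some V i then occurs more than c
   times in a row, so each further M' absorbs a bounded number of factors M. *)
Lemma engel_bounded (V : I -> L) (Ve : nat -> I -> L) (b d : nat) :
    size s <= b ->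
    (forall i, i \in s -> lact T (V i) c.+1 <=' lbot) ->
    (forall e i, i \in s -> Ve e i <=' V i) ->
    T *' lsums (Ve 0) <=' T ->
    (forall e i j, i \in s -> j \in s -> Ve e i *' Ve e j <=' lsums (Ve e.+1)) ->
    (forall e, lsums (Ve e.+1) <=' lsums (Ve e)) ->
    lsums (Ve d) <=' lbot ->
  lact T (lsums (Ve 0)) (engel_bound b c d) <=' lbot.
Proof.
move=> le_sb TV VeV TM VV; elim: d Ve VeV TM VV => [|d IHd] Ve VeV TM VV Mdec Md.
  (* The bound is [1] for [d = 0]: a single factor, which is zero. *)
  by rewrite /lact /=; apply: lmulr_le_bot.
set M := lsums (Ve 0) in TM *; set M' := lsums (Ve 1).
have MM : M *' M <=' M'.
  by apply: lmul_supl => _ [i si ->]; apply: lmul_supr => _ [j sj ->]; apply: VV.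
have M'M : M' *' M <=' M' := lle_trans (lmul_monol _ (Mdec 0)) MM.
have VM i : i \in s -> Ve 0 i <=' M by move=> si; apply: lsup_ub; exists i.
have {IHd} IH : lact T M' (engel_bound b c d) <=' lbot.
  apply: (IHd (fun e => Ve e.+1)) => // [e i||e i j].
  - exact: VeV.
  - exact: lle_trans (lmul_monor _ (Mdec 0)) TM.
  - exact: VV.
pose F t := lact T M' t.
have FM t : F t *' M <=' F t.
  elim: t => //= t IHt; apply: ljacobi; first exact: lmul_monol.
  exact: lmul_monor.
have FT t : F t <=' T.
  elim: t => [|t IHt]; first exact: lle_refl.
  exact: lle_trans (lmul_mono IHt (Mdec 0)) TM.
have Fstep t : lact (F t) M (b * c).+1 <=' F t.+1.
  apply: lact_sums => w sws sz_w.
  have [|i si lt_ci] := pigeonhole_seq sws _; first by rewrite sz_w ltnS leq_mul.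
  apply: lle_trans (wact_collect (F := F t) (M' := M') _ _ _ (lle_refl _) si sws) _.
  - by move=> j sj; apply: lle_trans (lmul_monor _ (VM j sj)) (FM t).
  - by move=> j sj; apply: lle_trans (lmul_monor _ (VM j sj)) (FM t.+1).
  - by move=> j k sj sk; apply: VV.
  apply: ljoin_lub (lle_refl _); apply: lle_trans (lbot_le _).
  have : lact (F t) (Ve 0 i) (count_mem i w) <=' lbot.
    rewrite -(subnK lt_ci) /lact iterD; apply: lact_bot.
    exact: lle_trans (lact_mono _ (FT t) (VeV 0 i si)) (TV i si).
  elim: [seq _ <- w | _] (lact _ _ _) => //= j w' IHw z z0.
  exact: IHw (lmul_le_bot _ _ z0).
have Fall t : lact T M ((b * c).+1 * t) <=' F t.
  elim: t => [|t IHt]; first by rewrite muln0; apply: lle_refl.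
  rewrite mulnS /lact iterD.
  exact: lle_trans (lact_mono _ IHt (lle_refl _)) (Fstep t).
by rewrite /engel_bound expnS; apply: lle_trans (Fall _) IH.
Qed.

End Engel.

(** * Kreknin's theorem for gradings by Z/n *)

Section Kreknin.

Variables (n N : nat).
Hypothesis n_gt0 : 0 < n.
Implicit Types X S : nat -> L.

Definition graded X :=
  forall i j, i < n -> j < n -> X i *' X j <=' X ((i + j) %% n).

Definition derg X (k : nat) : L :=
  lsup (fun z => exists i j, [/\ i < n, j < n, (i + j) %% n = k & z = X i *' X j]).

Lemma derg_lub X k z :
    (forall i j, i < n -> j < n -> (i + j) %% n = k -> X i *' X j <=' z) ->
  derg X k <=' z.
Proof. by move=> Xz; apply: lsup_lub => _ [i [j [lti ltj ij ->]]]; apply: Xz. Qed.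

Lemma mul_derg X i j : i < n -> j < n -> X i *' X j <=' derg X ((i + j) %% n).
Proof. by move=> lti ltj; apply: lsup_ub; exists i, j. Qed.

Lemma derg_sub X k : graded X -> derg X k <=' X k.
Proof. by move=> gX; apply: derg_lub => i j lti ltj <-; apply: gX. Qed.

Lemma graded_derg X : graded X -> graded (derg X).
Proof.
move=> gX i j lti ltj; apply: lle_trans (mul_derg X lti ltj).
by apply: lmul_mono; apply: derg_sub.
Qed.

Lemma graded_iter X e : graded X -> graded (iter e derg X).
Proof. by move=> gX; elim: e => //= e; apply: graded_derg. Qed.

Lemma iter_derg_sub X e k : graded X -> iter e derg X k <=' X k.
Proof.
move=> gX; elim: e => [|e IHe]; first exact: lle_refl.
exact: lle_trans (derg_sub _ (graded_iter _ gX)) IHe.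
Qed.

Lemma modn_add i j : i < n -> j < n ->
  (i + j) %% n = if i + j < n then i + j else i + j - n.
Proof.
move=> lti ltj; have [lt_ij|le_ij] := ltnP (i + j) n; first exact: modn_small.
by rewrite -{1}(subnK le_ij) modnDr modn_small //; lia.
Qed.

(** [N] rounds of [kreknin_steps k' + 1] derivations deal with degree [k], and [kreknin_steps k']
    more with the lower degrees. *)
Fixpoint kreknin_steps (k : nat) : nat :=
  if k is k'.+1 then N * (kreknin_steps k').+1 + kreknin_steps k' else 0.

Section Step.

Variables (k : nat) (X S : nat -> L).
Hypotheses (k_gt0 : 0 < k) (ltkn : k < n) (gX : graded X) (gS : graded S).
Hypothesis XS : forall i, k < i < n -> X i <=' S i.

Let W i := if i == k then ljoin (S k) (X k *' X 0) else X i.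

(* The elements sending each X r into W; they form a graded subring, which contains X 0 and the
   X i with i >= k, and to which the induction hypothesis of Kreknin's theorem applies. *)
Let Gr i :=
  lsup (fun u => u <=' X i /\ forall r, r < n -> X r *' u <=' W ((r + i) %% n)).

Let mod_ltn i : i %% n < n.
Proof. by rewrite ltn_pmod. Qed.

Let Gr_graded : graded Gr.
Proof.
move=> i j lti ltj; apply: lmul_supl => u [uX uW]; apply: lmul_supr => v [vX vW].
apply: lsup_ub; split=> [|r ltr].
  exact: lle_trans (lmul_mono uX vX) (gX lti ltj).
apply: ljacobir.
  apply: lle_trans (lmul_monol _ (lle_trans (lmul_monor _ uX) (gX ltr lti))) _.
  have -> : (r + (i + j) %% n) %% n = ((r + i) %% n + j) %% n by rewrite modnDmr modnDml addnA.
  exact: vW.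
apply: lle_trans (lmul_monol _ (lle_trans (lmul_monor _ vX) (gX ltr ltj))) _.
have -> : (r + (i + j) %% n) %% n = ((r + j) %% n + i) %% n.
  by rewrite modnDmr modnDml -addnA (addnC j).
exact: uW.
Qed.

Let XW r i : r < n -> i < n -> (r + i) %% n != k -> X r *' X i <=' W ((r + i) %% n).
Proof. by move=> ltr lti /negPf ne_k; rewrite /W ne_k; apply: gX. Qed.

Let XGr i : i = 0 \/ k <= i < n -> X i <=' Gr i.
Proof.
move=> Hi; have lti : i < n by case: Hi => [->|/andP[]].
apply: lsup_ub; split=> [|r ltr]; first exact: lle_refl.
have [def_k|] := eqVneq ((r + i) %% n) k; last exact: XW.
rewrite def_k /W eqxx; case: Hi => [i0|/andP[le_ki _]].
  by move: def_k; rewrite i0 addn0 modn_small // => ->; apply: lle_joinr (lle_refl _).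
have [k_i|ne_ki] := eqVneq i k.
  have -> : r = 0 by move: def_k; rewrite modn_add // k_i; case: ltnP; lia.
  by rewrite k_i; apply: lle_joinr (lmulC _ _).
(* Here [r + i = k + n] with [i < n], so both indices exceed [k] and [S] absorbs the product. *)
have ltk_r : k < r by move: def_k; rewrite modn_add //; case: ltnP; lia.
apply: lle_joinl; rewrite -def_k; apply: lle_trans (gS ltr lti).
by apply: lmul_mono; apply: XS; rewrite ?ltk_r ?ltr // lti andbT; lia.
Qed.

(** Products [X i *' X j] landing in degree [k] are of three kinds: one index is [0]; or
    [0 < i < k], and the assumption with [S' := Gr] applies to the left factor; or both indices
    exceed [k], and [S] contains the product. *)
Lemma kreknin_step e :
    (forall S', graded S' -> X 0 <=' S' 0 ->
       (forall i, k.-1 < i < n -> X i <=' S' i) ->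
       forall i, 0 < i < k -> iter e derg X i <=' S' i) ->
  iter e.+1 derg X k <=' ljoin (S k) (X k *' X 0).
Proof.
move=> IHe; have subX i := iter_derg_sub e i gX.
have sGr i : 0 < i < k -> iter e derg X i <=' Gr i.
  apply: IHe => // [|j /andP[lt_kj ltj]]; first by apply: XGr; left.
  by apply: XGr; right; rewrite ltj andbT -(prednK k_gt0).
apply: derg_lub => i j lti ltj def_k.
have [i0|i_gt0] := posnP i.
  move: def_k; rewrite i0 add0n modn_small // => ->; apply: lle_joinr.
  by apply: lle_trans (lmulC _ _) (lmul_mono _ _); apply: subX.
have [j0|j_gt0] := posnP j.
  by move: def_k; rewrite j0 addn0 modn_small // => ->; apply: lle_joinr; apply: lmul_mono; apply: subX.
have [lt_ik|le_ki] := ltnP i k.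
  apply: lle_trans (lmul_mono (sGr i _) (subX j)) _; first by rewrite i_gt0.
  apply: lmul_supl => u [_ uW]; apply: lle_trans (lmulC _ _) _.
  by have := uW j ltj; rewrite addnC def_k /W eqxx.
apply: lle_joinl; rewrite -def_k; apply: lle_trans (gS lti ltj).
have [lt_ki lt_kj] : k < i /\ k < j.
  by move: def_k; rewrite modn_add //; case: ltnP; lia.
by apply: lmul_mono; apply: lle_trans (subX _) (XS _); rewrite ?lt_ki ?lt_kj.
Qed.

End Step.

(** Quantifying over all graded [S] is what makes the induction on [k] work: the step lemma uses the
    induction hypothesis for the auxiliary subring [Gr]. *)
Lemma kreknin_sub k X S :
    k < n -> graded X -> (forall i, i < n -> lact (X i) (X 0) N <=' lbot) ->
    graded S -> X 0 <=' S 0 -> (forall i, k < i < n -> X i <=' S i) ->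
  forall i, 0 < i <= k -> iter (kreknin_steps k) derg X i <=' S i.
Proof.
elim: k X S => [|k IHk] X S ltkn gX X0N gS XS0 XS i; first by case: i.
have {}IHk Y S' : graded Y -> (forall i, Y i <=' X i) -> graded S' -> Y 0 <=' S' 0 ->
    (forall i, k < i < n -> Y i <=' S' i) ->
    forall i, 0 < i <= k -> iter (kreknin_steps k) derg Y i <=' S' i.
  move=> gY YX; apply: IHk => // [|j ltj]; first exact: ltnW.
  exact: lle_trans (lact_mono _ (YX j) (YX 0)) (X0N j ltj).
set e := kreknin_steps k in IHk.
(* Modulo [S], each round of [e + 1] derivations gains one more factor [X 0]; after [N] rounds
   nothing is left. *)
have stepN t : iter (t * e.+1) derg X k.+1 <=' ljoin (S k.+1) (lact (X k.+1) (X 0) t).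
  elim: t => [|t IHt]; first exact: lle_joinr (lle_refl _).
  rewrite mulSn iterD; set Y := iter (t * e.+1) derg X in IHt *.
  have gY : graded Y by apply: graded_iter.
  have YX j : Y j <=' X j by apply: iter_derg_sub.
  have := @kreknin_step k.+1 Y S isT ltkn gY gS.
  move=> /(_ (fun j Hj => lle_trans (YX j) (XS j Hj)) e) step.
  apply: lle_trans (step _) _ => [S' gS' YS0 YS j Hj|].
    by apply: (IHk Y S') => //; rewrite -ltnS.
  apply: ljoin_lub; first exact: lle_joinl (lle_refl _).
  apply: lle_trans (lmul_mono IHt (YX 0)) (lmul_joinl _ _); last exact: lle_joinr (lle_refl _).
  apply: lle_joinl; apply: lle_trans (lmul_monor _ XS0) _.
  by have := gS k.+1 0 ltkn n_gt0; rewrite addn0 modn_small.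
rewrite /= -/e addnC iterD; set Y := iter (N * e.+1) derg X.
have gY : graded Y by apply: graded_iter.
have YX j : Y j <=' X j by apply: iter_derg_sub.
have Yk : Y k.+1 <=' S k.+1.
  apply: lle_trans (stepN N) (ljoin_lub (lle_refl _) _).
  exact: lle_trans (X0N _ ltkn) (lbot_le _).
case/andP=> i_gt0; rewrite leq_eqVlt => /predU1P[->|lt_ik].
  exact: lle_trans (iter_derg_sub _ _ gY) Yk.
apply: (IHk Y S) => //; rewrite ?i_gt0 //; first exact: lle_trans (YX 0) XS0.
move=> j /andP[lt_kj ltj]; have [->//|ne_jk] := eqVneq j k.+1.
by apply: lle_trans (YX j) (XS j _); rewrite ltj andbT; lia.
Qed.

Definition kreknin_length := kreknin_steps n.-1 + N.

(* Kreknin's theorem is the case X 0 = 0. *)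
Theorem kreknin X k :
    k < n -> graded X -> (forall i, i < n -> lact (X i) (X 0) N <=' lbot) ->
  iter kreknin_length derg X k <=' lbot.
Proof.
move=> ltkn gX X0N; rewrite /kreknin_length addnC iterD.
set Y := iter _ derg X; have gY : graded Y by apply: graded_iter.
have YX j : Y j <=' X j by apply: iter_derg_sub.
(* The subring concentrated in degree 0: falling into it means vanishing in all other degrees. *)
pose S i := if i == 0 then X 0 else lbot.
have gS : graded S.
  rewrite /S => -[|i] [|j] lti ltj /=; try by [apply: lmul_botl | apply: lmul_botr].
  by rewrite mod0n /=; have := gX 0 0 lti ltj; rewrite mod0n.
have Yi i : 0 < i < n -> Y i <=' lbot.
  case/andP=> i_gt0 ltin; have -> : lbot = S i by rewrite /S gtn_eqF.
  apply: kreknin_sub => // [||j|]; rewrite ?ltn_predL //; first exact: lle_refl.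
    by case/andP; lia.
  by lia.
have {Yi} Yti t i : 0 < i < n -> iter t derg Y i <=' lbot.
  by move=> Hi; apply: lle_trans (iter_derg_sub _ _ gY) (Yi i Hi).
(* With the other degrees gone, only products within degree 0 contribute, and there [X 0] acts
   nilpotently on itself. *)
have Yt0 t : iter t derg Y 0 <=' lact (X 0) (X 0) t.
  elim: t => [|t IHt]; first exact: YX.
  apply: derg_lub => -[|i] j lti ltj ij; last by apply: lmul_le_bot; apply: Yti.
  move: ij; rewrite add0n modn_small // => ->; apply: lmul_mono IHt _.
  exact: lle_trans (iter_derg_sub _ _ gY) (YX 0).
case: k ltkn => [|k] ltkn; last exact: Yti.
exact: lle_trans (Yt0 N) (X0N 0 ltkn).
Qed.

End Kreknin.
End LieLattice.

(** * Graded Lie rings with an adjoined root of unity *)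

Section GradedLie.

Local Open Scope ring_scope.

(* The degree n of a bracket is a parameter, meaningful when n = i + j; this avoids transports
   along equations between degrees. *)
Record graded_lie := GradedLie {
  gl :> nat -> zmodType;
  br : forall i j n, gl i -> gl j -> gl n;
  brDl : forall i j n (x x' : gl i) (y : gl j), n = (i + j)%N ->
    br n (x + x') y = br n x y + br n x' y;
  brC : forall i j n (x : gl i) (y : gl j), n = (i + j)%N -> br n x y = - br n y x;
  br_jacobi : forall i j k ij ik jk n (x : gl i) (y : gl j) (z : gl k),
    ij = (i + j)%N -> ik = (i + k)%N -> jk = (j + k)%N -> n = (i + j + k)%N ->
    br n (br ij x y) z = br n (br ik x z) y + br n x (br jk y z)
}.

Section Convolution.

Variables (g : graded_lie) (p : nat).

(* gl n tensored with the group ring of Z/p; in cspan it is taken modulo constant functions, so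
   that the generator of Z/p plays the part of a primitive p-th root of unity. *)
Definition fgl (n : nat) : zmodType := {ffun 'F_p -> g n}.

Definition fconv i j n (f : fgl i) (h : fgl j) : fgl n :=
  [ffun m => \sum_(u : 'F_p) br n (f u) (h (m - u))].

Lemma brDr i j n (x : g i) (y y' : g j) : n = (i + j)%N ->
  br n x (y + y') = br n x y + br n x y'.
Proof. by move=> dn; rewrite !(brC x) // brDl ?opprD // addnC. Qed.

Lemma br0l i j n (y : g j) : n = (i + j)%N -> br n (0 : g i) y = 0.
Proof. by move=> dn; apply: (addIr (br n (0 : g i) y)); rewrite -brDl // !add0r. Qed.

Lemma br0r i j n (x : g i) : n = (i + j)%N -> br n x (0 : g j) = 0.
Proof. by move=> dn; apply: (addIr (br n x (0 : g j))); rewrite -brDr // !add0r. Qed.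

Lemma br_suml (I : Type) (r : seq I) (P : pred I) i j n (F : I -> g i) (y : g j) :
  n = (i + j)%N -> br n (\sum_(k <- r | P k) F k) y = \sum_(k <- r | P k) br n (F k) y.
Proof.
move=> dn; apply: (big_morph (fun x => br n x y)); last exact: br0l.
by move=> x x'; apply: brDl.
Qed.

Lemma br_sumr (I : Type) (r : seq I) (P : pred I) i j n (x : g i) (F : I -> g j) :
  n = (i + j)%N -> br n x (\sum_(k <- r | P k) F k) = \sum_(k <- r | P k) br n x (F k).
Proof.
move=> dn; apply: (big_morph (fun y => br n x y)); last exact: br0r.
by move=> y y'; apply: brDr.
Qed.

Lemma fconvDl i j n (f f' : fgl i) (h : fgl j) : n = (i + j)%N ->
  fconv n (f + f') h = fconv n f h + fconv n f' h.
Proof.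
move=> dn; apply/ffunP=> m; rewrite !ffunE -big_split; apply: eq_bigr => u _.
by rewrite ffunE brDl.
Qed.

Lemma fconvC i j n (f : fgl i) (h : fgl j) : n = (i + j)%N ->
  fconv n f h = - fconv n h f.
Proof.
move=> dn; apply/ffunP=> m; rewrite !ffunE -sumrN.
rewrite (reindex_inj (inv_inj (subKr m))); apply: eq_bigr => u _.
by rewrite subKr brC.
Qed.

(** Constant functions form an ideal, so brackets make sense modulo them. *)
Lemma fconv_const i j n (f : fgl i) (h : fgl j) : n = (i + j)%N ->
  (forall u v, f u = f v) -> forall u v, fconv n f h u = fconv n f h v.
Proof.
move=> dn cf; suff E u : fconv n f h u = \sum_v br n (f 0) (h v) by move=> u v; rewrite !E.
rewrite ffunE (reindex_inj (inv_inj (subKr u))); apply: eq_bigr => v _.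
by rewrite subKr (cf _ 0).
Qed.

Lemma fconv_jacobi i j k ij ik jk n (x : fgl i) (y : fgl j) (z : fgl k) :
    ij = (i + j)%N -> ik = (i + k)%N -> jk = (j + k)%N -> n = (i + j + k)%N ->
  fconv n (fconv ij x y) z = fconv n (fconv ik x z) y + fconv n x (fconv jk y z).
Proof.
move=> dij dik djk dn; apply/ffunP=> m.
(* With the last argument at [m - u - v], the Jacobi identity can be applied term by term. *)
have convE i' j' k' ij' (x' : fgl i') (y' : fgl j') (z' : fgl k') :
    ij' = (i' + j')%N -> n = (ij' + k')%N ->
    fconv n (fconv ij' x' y') z' m =
    \sum_u \sum_v br n (br ij' (x' u) (y' v)) (z' (m - u - v)).
  move=> dij' dn'; rewrite ffunE.
  transitivity (\sum_w \sum_u br n (br ij' (x' u) (y' (w - u))) (z' (m - w))).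
    by apply: eq_bigr => w _; rewrite ffunE br_suml.
  rewrite exchange_big; apply: eq_bigr => u _; rewrite (reindex_inj (addrI u)).
  by apply: eq_bigr => v _; rewrite addrAC subrr add0r opprD addrA.
rewrite [RHS]ffunE !convE //; try by rewrite ?dij ?dik ?dn // addnAC.
rewrite [X in _ = _ + X]ffunE -big_split; apply: eq_bigr => u _.
rewrite [X in _ = X + _](reindex_inj (inv_inj (subKr (m - u)))).
rewrite ffunE br_sumr ?dn ?djk ?addnA // -big_split; apply: eq_bigr => v _.
rewrite subKr; apply: br_jacobi => //.
Qed.

Definition fdelta n (u : 'F_p) (v : g n) : fgl n := [ffun w => if w == u then v else 0].

Lemma fdeltaD n u : {morph @fdelta n u : v w / v + w}.
Proof. by move=> v w; apply/ffunP=> x; rewrite !ffunE; case: eqP; rewrite ?addr0. Qed.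

Lemma fdelta0 n u : @fdelta n u 0 = 0.
Proof. by apply/ffunP=> x; rewrite !ffunE; case: eqP. Qed.

Lemma fdelta_sum n (f : fgl n) : f = \sum_u fdelta u (f u).
Proof.
apply/ffunP=> x; rewrite sum_ffunE (bigD1 x) //= ffunE eqxx big1 ?addr0 // => u.
by rewrite ffunE eq_sym => /negPf->.
Qed.

Lemma fconv_fdelta i j n (x : g i) (y : g j) (u : 'F_p) : n = (i + j)%N ->
  fconv n (fdelta u x) (fdelta 0 y) = fdelta u (br n x y).
Proof.
move=> dn; apply/ffunP=> m; rewrite !ffunE (bigD1 u) // !ffunE eqxx subr_eq0.
rewrite big1 => [|v /negPf ne_vu]; last by rewrite ffunE ne_vu br0l.
by rewrite [LHS]addr0; case: eqP; rewrite ?br0r.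
Qed.

Inductive cspan n (S : fgl n -> Prop) : fgl n -> Prop :=
| cspan_gen (f : fgl n) : S f -> cspan S f
| cspan_const (f : fgl n) : (forall u v, f u = f v) -> cspan S f
| cspan_add f h : cspan S f -> cspan S h -> cspan S (f + h)
| cspan_opp f : cspan S f -> cspan S (- f).

Lemma cspan_trans n (S S' : fgl n -> Prop) f :
  cspan S f -> (forall h, S h -> cspan S' h) -> cspan S' f.
Proof.
move=> Sf SS'; elim: Sf => [h /SS' // | h | h h' _ ? _ | h _].
- exact: cspan_const.
- exact: cspan_add.
- exact: cspan_opp.
Qed.

Lemma cspan0 n (S : fgl n -> Prop) : cspan S 0.
Proof. by apply: cspan_const => u v; rewrite !ffunE. Qed.

Lemma cspan_sum n (S : fgl n -> Prop) (I : Type) (r : seq I) (P : pred I) (F : I -> fgl n) :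
  (forall i, P i -> cspan S (F i)) -> cspan S (\sum_(i <- r | P i) F i).
Proof. by move=> SF; apply: big_ind => //; [apply: cspan0 | apply: cspan_add]. Qed.

Definition fl_car := forall n, fgl n -> Prop.
Definition fl_le (X Y : fl_car) := forall n f, X n f -> cspan (Y n) f.
Definition fl_sup (P : fl_car -> Prop) : fl_car := fun n f => exists2 X, P X & X n f.
Definition fl_mul (X Y : fl_car) : fl_car := fun n h =>
  exists i j (f1 : fgl i) (f2 : fgl j), [/\ n = (i + j)%N, X i f1, Y j f2 & h = fconv n f1 f2].

Lemma cspan_mull (X Y : fl_car) i j n (f : fgl i) (h : fgl j) : n = (i + j)%N ->
  cspan (X i) f -> Y j h -> cspan (@fl_mul X Y n) (fconv n f h).
Proof.
move=> dn Xf Yh; elim: Xf => [f' Xf' | f' cf' | f1 f2 _ ? _ ? | f' _ ?].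
- by apply: cspan_gen; exists i, j, f', h.
- exact/cspan_const/fconv_const.
- by rewrite fconvDl //; apply: cspan_add.
- rewrite (_ : fconv n (- f') h = - fconv n f' h); first exact: cspan_opp.
  by apply: (addIr (fconv n f' h)); rewrite -fconvDl // !addNr; apply/ffunP=> m;
     rewrite !ffunE big1 // => u _; rewrite ffunE br0l.
Qed.

Lemma cspan_mul (X Y : fl_car) i j n (f : fgl i) (h : fgl j) : n = (i + j)%N ->
  cspan (X i) f -> cspan (Y j) h -> cspan (@fl_mul X Y n) (fconv n f h).
Proof.
move=> dn Xf Yh; rewrite fconvC //; apply: cspan_opp.
have Yf := @cspan_mull Y (fun m => cspan (@X m)) j i n h f (etrans dn (addnC _ _)) Yh Xf.
apply: cspan_trans Yf _ => _ [j' [i' [h' [f' [dn' Yh' Xf' ->]]]]].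
rewrite fconvC //; apply/cspan_opp/cspan_mull => //.
by rewrite dn' addnC.
Qed.

Local Obligation Tactic := idtac.

Program Definition fl_lattice : lie_lattice :=
  @LieLattice fl_car fl_le fl_sup fl_mul _ _ _ _ _ _ _ _.
Next Obligation. by move=> X n f Xf; apply: cspan_gen. Qed.
Next Obligation.
by move=> Y X Z XY YZ n f /XY/cspan_trans; apply; apply: YZ.
Qed.
Next Obligation. by move=> P X PX n f Xf; apply: cspan_gen; exists X. Qed.
Next Obligation. by move=> P Y PY n f [X PX /(PY X PX)]. Qed.
Next Obligation.
move=> X Y n _ [i [j [f1 [f2 [dn X1 Y2 ->]]]]]; rewrite fconvC //.
by apply/cspan_opp/cspan_gen; exists j, i, f2, f1; rewrite addnC.
Qed.
Next Obligation.
move=> X X' Y XX' n _ [i [j [f1 [f2 [dn /XX' X1 Y2 ->]]]]].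
exact: cspan_mull.
Qed.
Next Obligation.
move=> P Y Z PYZ n _ [i [j [f1 [f2 [dn [X PX X1] Y2 ->]]]]].
by apply: (PYZ X PX); exists i, j, f1, f2.
Qed.
Next Obligation.
move=> X Y Z W XZY XYZ n _ [ij [k [_ [f3 [dn [i [j [f1 [f2 [dij X1 Y2 ->]]]]] Z3 ->]]]]].
rewrite (@fconv_jacobi i j k ij (i + k) (j + k)) ?dn ?dij //; apply: cspan_add.
  apply: XZY; exists (i + k)%N, j, (fconv (i + k) f1 f3), f2; split=> //; first by rewrite addnAC.
  by exists i, k, f1, f3.
apply: XYZ; exists i, (j + k)%N, f1, (fconv (j + k) f2 f3); split=> //; first by rewrite addnA.
by exists j, k, f2, f3.
Qed.

End Convolution.

End GradedLie.

(** * The Lie ring of the lower central series *)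

Section LowerCentral.

Local Open Scope group_scope.

Lemma three_subgroup_sub (gT : finGroupType) (N X Y Z : {group gT}) :
    X \subset 'N(N) -> Y \subset 'N(N) -> Z \subset 'N(N) ->
    [~: X, Y, Z] \subset N -> [~: Y, Z, X] \subset N -> [~: Z, X, Y] \subset N.
Proof.
move=> nX nY nZ sXYZ sYZX.
have quo_comm (U V W : {group gT}) : U \subset 'N(N) -> V \subset 'N(N) ->
    W \subset 'N(N) -> ([~: U, V, W] \subset N) = ([~: U / N, V / N, W / N] == 1).
  move=> nU nV nW; have nUV : [~: U, V] \subset 'N(N) by apply: comm_subG.
  by rewrite -(quotientR nU nV) -(quotientR nUV nW) -subG1 quotient_sub1 // comm_subG.
by rewrite quo_comm //; apply/eqP/three_subgroup; apply/eqP; rewrite -quo_comm.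
Qed.

(** Induction on [j] by the three subgroups lemma; ['L_0(G)] is [G], so [j = 0] only says that the
    terms are normal. *)
Lemma commg_lcn (gT : finGroupType) (G : {group gT}) i j :
  [~: 'L_i(G), 'L_j(G)] \subset 'L_(i + j)(G).
Proof.
elim: j i => [|[|j] IHj] i.
- by rewrite addn0 commg_subl lcn_norm.
- by rewrite addn1 lcnSnS.
have nL m : 'L_m(G) \subset 'N('L_(i + j.+2)(G)).
  exact: subset_trans (lcn_sub m G) (lcn_norm _ G).
rewrite commGC; apply: (three_subgroup_sub (N := 'L_(i + j.+2)(G)) (X := G) (Z := 'L_j.+1(G))).
- exact: lcn_norm.
- exact: nL.
- exact: nL.
- rewrite (commGC G); apply: subset_trans (commSg _ (lcnSnS i G)) _.
  by rewrite -addSnnS IHj.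
- by apply: subset_trans (commSg _ (IHj i)) _; rewrite (addnS i j.+1) lcnSnS.
Qed.

Section LowerCentralLie.

Variables (gT : finGroupType) (K : {group gT}).

Local Notation L n := 'L_n(K).

Lemma lcn_section_abelian n : abelian (L n / L n.+1).
Proof.
rewrite /abelian quotient_cents2r // (subset_trans _ (lcnSnS n K)) //.
by rewrite commgS ?lcn_sub.
Qed.

(** Degree 0 is trivial, as [L 0] and [L 1] are both [K]. *)
Definition lgr n := fmod_of (lcn_section_abelian n).

Definition lproj n (x : gT) : lgr n := fmod (lcn_section_abelian n) (coset (L n.+1) x).

Definition lrep n (v : lgr n) : gT := repr (val v).

Let nLK n m : L m \subset 'N(L n).
Proof. exact: subset_trans (lcn_sub m K) (lcn_norm n K). Qed.

Lemma lprojM n : {in L n &, {morph lproj n : x y / x * y >-> (x + y)%R}}.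
Proof.
move=> x y Lx Ly; rewrite /lproj morphM ?(subsetP (nLK _ n)) //.
by rewrite fmodM ?mem_quotient.
Qed.

Lemma lproj_eq0 n x : x \in L n -> (lproj n x == 0%R) = (x \in L n.+1).
Proof.
move=> Lx; rewrite -(inj_eq val_inj) fmodK ?mem_quotient //.
by apply/eqP/idP=> [/coset_idr-> //|/coset_id //]; apply: subsetP (nLK _ n) _ Lx.
Qed.

Lemma lprojV n x : x \in L n -> lproj n x^-1 = (- lproj n x)%R.
Proof. by move=> Lx; rewrite /lproj morphV ?(subsetP (nLK _ n)) // fmodV. Qed.

Lemma lproj1 n : lproj n 1 = 0%R.
Proof. by rewrite /lproj morph1 fmod1. Qed.

Lemma lrep_mem n v : @lrep n v \in L n.
Proof.
have: val v \in L n / L n.+1 := fmodP v.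
case/morphimP=> x nx Lx defv; rewrite /lrep defv /= val_coset //.
have /rcosetP[y Ly ->] := mem_repr_rcoset (L n.+1) x.
by rewrite groupM // (subsetP (lcn_subS n K)).
Qed.

Lemma lrepK n : cancel (@lrep n) (@lproj n).
Proof.
by move=> v; rewrite /lproj /lrep coset_reprK fmvalK.
Qed.

Lemma lproj_eq n x y : x \in L n -> y \in L n ->
  (lproj n x == lproj n y) = (x * y^-1 \in L n.+1).
Proof.
by move=> Lx Ly; rewrite -subr_eq0 -lprojV // -lprojM ?groupV // lproj_eq0 // groupM ?groupV.
Qed.

Lemma mem_commg_lcn i j n x y : n = (i + j)%N -> x \in L i -> y \in L j -> [~ x, y] \in L n.
Proof. by move=> -> Lx Ly; apply: (subsetP (commg_lcn K i j)); rewrite mem_commg. Qed.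

Lemma lprojJ n x y : x \in L n -> y \in K -> lproj n (x ^ y) = lproj n x.
Proof.
move=> Lx Ky; have LRxy : [~ x, y] \in L n.+1.
  by apply: (subsetP (lcnSnS n K)); rewrite mem_commg.
have LR := subsetP (lcn_subS n K) _ LRxy.
have /eqP z0 : lproj n [~ x, y] == 0%R by rewrite lproj_eq0.
by rewrite conjg_mulR lprojM // z0 addr0.
Qed.

Lemma lprojRl i j n x x' y : n = (i + j)%N -> x \in L i -> x' \in L i -> y \in L j ->
  lproj n [~ x * x', y] = (lproj n [~ x, y] + lproj n [~ x', y])%R.
Proof.
move=> dn Lx Lx' Ly; have [Lxy Lxy'] := (mem_commg_lcn dn Lx Ly, mem_commg_lcn dn Lx' Ly).
have Kx' := subsetP (lcn_sub i K) _ Lx'.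
by rewrite commMgJ lprojM ?lprojJ // memJ_norm // (subsetP (lcn_norm n K)).
Qed.

Lemma lprojRC n x y : [~ x, y] \in L n -> lproj n [~ y, x] = (- lproj n [~ x, y])%R.
Proof. by move=> Lxy; rewrite -invg_comm lprojV. Qed.

Definition lbr i j n (v : lgr i) (w : lgr j) : lgr n := lproj n [~ lrep v, lrep w].

Lemma lbrC i j n (v : lgr i) (w : lgr j) : n = (i + j)%N ->
  lbr n v w = (- lbr n w v)%R.
Proof.
by move=> dn; rewrite /lbr lprojRC // (mem_commg_lcn (i := j) (j := i)) ?lrep_mem // addnC.
Qed.

(** The bracket does not depend on the representatives: changing one by an element of the next term
    changes the commutator by an element of [L n.+1]. *)
Lemma lbrE i j n x y : n = (i + j)%N -> x \in L i -> y \in L j ->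
  lbr n (lproj i x) (lproj j y) = lproj n [~ x, y].
Proof.
move=> dn Lx Ly.
have lbr_l i' j' x1 x2 y' : n = (i' + j')%N -> x1 \in L i' -> x2 \in L i' -> y' \in L j' ->
    lproj i' x1 = lproj i' x2 -> lproj n [~ x1, y'] = lproj n [~ x2, y'].
  move=> dn' L1 L2 Ly' /eqP; rewrite lproj_eq // => L12.
  have L12' := subsetP (lcn_subS i' K) _ L12.
  have /eqP z0 : lproj n [~ x1 * x2^-1, y'] == 0%R.
    rewrite lproj_eq0; last exact: mem_commg_lcn dn' L12' Ly'.
    by apply: (mem_commg_lcn _ L12 Ly'); rewrite dn'.
  by rewrite -(mulgKV x2 x1) (lprojRl dn' L12' L2 Ly') z0 add0r.
rewrite /lbr (lbr_l i j _ x) ?lrep_mem ?lrepK //.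
rewrite lprojRC; last by apply: (mem_commg_lcn (i := j) (j := i)); rewrite ?lrep_mem // addnC.
rewrite (lbr_l j i _ y) ?lrep_mem ?lrepK //; last by rewrite addnC.
by rewrite -lprojRC //; apply: (mem_commg_lcn (i := j) (j := i)); rewrite // addnC.
Qed.

Lemma lbrDl i j n (v v' : lgr i) (w : lgr j) : n = (i + j)%N ->
  lbr n (v + v')%R w = (lbr n v w + lbr n v' w)%R.
Proof.
move=> dn; rewrite -(lrepK v) -(lrepK v') -(lrepK w) -lprojM ?lrep_mem //.
by rewrite !lbrE ?groupM ?lrep_mem // (lprojRl dn) ?lrep_mem.
Qed.

Lemma lbrNl i j n (v : lgr i) (w : lgr j) : n = (i + j)%N ->
  lbr n (- v)%R w = (- lbr n v w)%R.
Proof.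
move=> dn; have lbr0 : lbr n (0 : lgr i)%R w = 0%R.
  by apply: (addIr (lbr n (0 : lgr i)%R w)); rewrite -lbrDl // !add0r.
by apply: (addIr (lbr n v w)); rewrite -lbrDl // !addNr lbr0.
Qed.

Lemma lbrNr i j n (v : lgr i) (w : lgr j) : n = (i + j)%N ->
  lbr n v (- w)%R = (- lbr n v w)%R.
Proof. by move=> dn; rewrite lbrC // lbrNl 1?addnC // [in RHS]lbrC. Qed.

Lemma lbr_jacobi i j k ij ik jk n (x : lgr i) (y : lgr j) (z : lgr k) :
    ij = (i + j)%N -> ik = (i + k)%N -> jk = (j + k)%N -> n = (i + j + k)%N ->
  lbr n (lbr ij x y) z = (lbr n (lbr ik x z) y + lbr n x (lbr jk y z))%R.
Proof.
move=> dij dik djk dn.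
have [dn1 dn2 dn3] : [/\ n = (ij + k)%N, n = (jk + i)%N & n = (ik + j)%N].
  by split; lia.
(* Each Hall-Witt factor becomes minus a double bracket: the inverted entry gives the sign, and
   conjugation by [w] is trivial on sections. *)
have termE i' j' k' ij' (x' : lgr i') (y' : lgr j') (z' : lgr k') (w : gT) :
    ij' = (i' + j')%N -> n = (ij' + k')%N -> w \in K ->
    lproj n ([~ lrep x', (lrep y')^-1, lrep z'] ^ w) = (- lbr n (lbr ij' x' y') z')%R.
  move=> d1 d2 Kw; have [[Lx Ly] Lz] := (lrep_mem x', lrep_mem y', lrep_mem z').
  have Ly' := groupVr Ly; have Lxy := mem_commg_lcn d1 Lx Ly'.
  rewrite (lprojJ (mem_commg_lcn d2 Lxy Lz) Kw) -(lbrE d2 Lxy Lz) -(lbrE d1 Lx Ly').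
  by rewrite lprojV // !lrepK lbrNr // lbrNl.
have [[Lx Ly] Lz] := (lrep_mem x, lrep_mem y, lrep_mem z).
have K_ m v : v \in L m -> v \in K by apply: subsetP (lcn_sub m K) v.
have := congr1 (lproj n) (Hall_Witt_identity (lrep x) (lrep y) (lrep z)).
have L3 i' j' k' ij' (x' : lgr i') (y' : lgr j') (z' : lgr k') (w : gT) :
    ij' = (i' + j')%N -> n = (ij' + k')%N -> w \in K ->
    [~ lrep x', (lrep y')^-1, lrep z'] ^ w \in L n.
  move=> d1 d2 Kw; rewrite memJ_norm ?(subsetP (lcn_norm n K)) //.
  by rewrite (mem_commg_lcn d2 (mem_commg_lcn d1 _ _)) ?groupV ?lrep_mem.
have dki : ik = (k + i)%N by lia.
have [Kx Ky Kz] := And3 (K_ _ _ Lx) (K_ _ _ Ly) (K_ _ _ Lz).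
have [La Lb Lc] := And3 (L3 _ _ _ _ x y z _ dij dn1 Ky) (L3 _ _ _ _ y z x _ djk dn2 Kz)
                        (L3 _ _ _ _ z x y _ dki dn3 Kx).
rewrite (lprojM (groupM La Lb) Lc) (lprojM La Lb).
rewrite (termE _ _ _ _ _ _ _ _ dij dn1 Ky) (termE _ _ _ _ _ _ _ _ djk dn2 Kz).
rewrite (termE _ _ _ _ _ _ _ _ dki dn3 Kx).
rewrite lproj1 -!opprD => /eqP; rewrite oppr_eq0 -addrA addr_eq0 => /eqP->.
rewrite opprD addrC; congr (_ + _)%R.
  by rewrite [lbr ik z x]lbrC // lbrNl ?opprK.
by rewrite [RHS]lbrC //; lia.
Qed.

Definition lcn_lie : graded_lie := GradedLie lbrDl lbrC lbr_jacobi.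

End LowerCentralLie.

End LowerCentral.

(** * Transfer between subgroups of K and additive subgroups of the Lie ring *)

Section ValuedFunctions.

Local Open Scope group_scope.

Variables (gT : finGroupType) (K : {group gT}) (p : nat).

Local Notation L n := 'L_n(K).
Local Notation lie := (lcn_lie K).
Local Notation lat := (fl_lattice lie p).
Local Notation E n := (fgl lie p n).

Definition gmem (W : lat) n (x : gT) :=
  forall u : 'F_p, cspan (W n) (@fdelta lie p n u (lproj K n x)).

Lemma gmem_le (W W' : lat) n x : lle W W' -> gmem W n x -> gmem W' n x.
Proof. by move=> WW' Wx u; apply: cspan_trans (Wx u) (WW' n). Qed.

Lemma gmem_lcnS W n x : x \in L n.+1 -> gmem W n x.
Proof.
move=> Lx u; have Lx' := subsetP (lcn_subS n K) _ Lx.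
have /eqP-> : lproj K n x == 0%R by rewrite lproj_eq0.
by rewrite fdelta0; apply: cspan0.
Qed.

Lemma gmem_gen W n (Z : {set gT}) : Z \subset L n -> {in Z, forall x, gmem W n x} ->
  {in <<Z>>, forall x, gmem W n x}.
Proof.
move=> sZL ZW _ /gen_prodgP[m [c Zc ->]] u.
suff [] : (\prod_i c i \in L n) /\ cspan (W n) (@fdelta lie p n u (lproj K n (\prod_i c i))) by [].
elim/big_ind: _ => [|x y [Lx Wx] [Ly Wy]|i _].
- by rewrite group1 lproj1 fdelta0; split=> //; apply: cspan0.
- by rewrite groupM // lprojM // fdeltaD; split=> //; apply: cspan_add.
- by rewrite (subsetP sZL) // ; split=> //; apply: ZW.
Qed.

(** Working modulo constants loses no information about [x]: a delta function that is constant is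
    zero, since ['F_p] has more than one element. *)
Lemma gmem_bot n x : x \in L n -> gmem (lbot lat) n x -> x \in L n.+1.
Proof.
move=> Lx /(_ 0%R) bot_x; rewrite -lproj_eq0 //.
have const f : cspan (@lbot lat n) f -> forall u v, f u = f v.
  elim=> [g [Y []] | // | g h _ cg _ ch u v | g _ cg u v]; rewrite !ffunE.
    by rewrite (cg u v) (ch u v).
  by rewrite (cg u v).
have := const _ bot_x 0%R 1%R; rewrite !ffunE eqxx oner_eq0.
by move=> ->.
Qed.

Implicit Types (X Y : nat -> {set gT}) (W : lat).

Definition valued (X : nat -> {set gT}) : lat :=
  fun n f => forall u, exists2 x, x \in X n :&: L n & f u = lproj K n x.

(** A delta function also takes the value 0, whence the condition [1 \in X n]. *)
Lemma gmem_valued X n x : x \in X n -> x \in L n -> 1 \in X n -> gmem (valued X) n x.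
Proof.
move=> Xx Lx X1 u; apply: cspan_gen => w; rewrite ffunE; case: eqP => _.
  by exists x; rewrite // inE Xx.
by exists 1; rewrite ?lproj1 // inE X1 group1.
Qed.

Lemma valued_le X W : (forall n x, x \in X n -> x \in L n -> gmem W n x) -> lle (valued X) W.
Proof.
move=> XW n f Xf; rewrite [f]fdelta_sum; apply: cspan_sum => u _.
by have [x /setIP[Xx Lx] ->] := Xf u; apply: XW.
Qed.

Lemma mul_valued_le X Y W :
    (forall i j x y, x \in X i -> x \in L i -> y \in Y j -> y \in L j ->
       gmem W (i + j) [~ x, y]) ->
  lle (lmul (valued X) (valued Y)) W.
Proof.
move=> XYW n _ [i [j [f [h [dn Xf Yh ->]]]]].
rewrite [fconv _ _ _]fdelta_sum; apply: cspan_sum => m _; rewrite ffunE.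
rewrite (big_morph _ (@fdeltaD lie p n m) (@fdelta0 lie p n m)); apply: cspan_sum => u _.
have [x /setIP[Xx Lx] ->] := Xf u; have [y /setIP[Yy Ly] ->] := Yh (m - u)%R.
rewrite [br _ _ _](lbrE dn Lx Ly) dn; exact: XYW.
Qed.

Lemma mul_gmem (X Y : lat) i j x y : x \in L i -> y \in L j ->
  gmem X i x -> gmem Y j y -> gmem (lmul X Y) (i + j) [~ x, y].
Proof.
move=> Lx Ly Xx Yy u; rewrite -(lbrE (erefl _) Lx Ly) -[lbr _ _ _]/(@br lie _ _ _ _ _).
rewrite -fconv_fdelta //.
by apply: cspan_mul.
Qed.

End ValuedFunctions.

(** * The nilpotency class *)

Section ClassBound.

Local Open Scope group_scope.

Lemma der_sub_lcn (gT : finGroupType) (G : {group gT}) n : G^`(n) \subset 'L_n.+1(G).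
Proof.
elim: n => // n IHn; rewrite lcnSn dergSn commgSS //.
exact: der_sub.
Qed.

Lemma der_add (gT : finGroupType) (G : {group gT}) m n : G^`(m)^`(n) = G^`(m + n).
Proof. by elim: n => [|n IHn]; rewrite ?addn0 // addnS !dergSn IHn. Qed.

Variables (gT : finGroupType) (p m c : nat) (A G : {group gT}).
Hypotheses (pr_p : prime p) (abelA : p.-abelem A) (p'G : p^'.-group G).
Hypothesis nGA : A \subset 'N(G).
Hypothesis ltpA : (p ^ m.+2 < #|A|)%N.
Hypothesis classC : {in A^#, forall a, 'L_c.+1('L_m.+1('C_G[a])) = 1}.

Local Notation hs := (large_subgroups p A).
Local Notation s := (specials p A G m).
Local Notation K := 'L_m.+1(G)%G.
Local Notation L n := 'L_n(K).
Local Notation lat := (fl_lattice (lcn_lie K) p).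
Local Notation b := ((2 ^ #|A|) ^ m.*2.+1)%N.
Local Notation gmem := (@gmem gT K p).
Local Notation valued := (@valued gT K p).

Implicit Types (B D H J X Y : {group gT}).

Let sKG : K \subset G := lcn_sub m.+1 G.
Let nKA : A \subset 'N(K) := char_norm_trans (lcn_char m.+1 G) nGA.
Let p'K : p^'.-group K := pgroupS sKG p'G.
Let nLA n : A \subset 'N(L n) := char_norm_trans (lcn_char n K) nKA.

Let genK : << \bigcup_(H in s) H >> = K := special_gen pr_p abelA p'G nGA m.

Let sHK H : H \in s -> H \subset K.
Proof. by move=> sH; rewrite -[gval K]genK sub_gen // (bigcup_max H). Qed.

Let A_hs : A \in hs.
Proof. by rewrite inE subxx leq_pmulr ?prime_gt0. Qed.

(** As [H'] lies in some ['C_G(B)], the centralizers in [Y] of large subgroups lie in special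
    subgroups of the next weight, hence in members of [s]. This is how brackets of pieces are again
    spanned by pieces. *)
Lemma special_comm_gen H H' Y : H \in s -> H' \in s -> Y \subset [~: H, H'] ->
  A \subset 'N(Y) -> Y \subset << \bigcup_(J in s) (J :&: Y) >>.
Proof.
move=> sH sH' sYHH nYA; have [B hB sHB] := special_cent sH'.
have sYG : Y \subset G.
  exact: subset_trans sYHH (comm_subG (special_subG sH) (special_subG sH')).
rewrite -{1}(coprime_gen_cent_large pr_p abelA (pgroupS sYG p'G) nYA).
rewrite genS //; apply/bigcupsP=> B' hB'.
have [J sJ sHJ] := special_mono (special_S sH hB hB').
rewrite (bigcup_max J) // subsetI subsetIl andbT (subset_trans _ sHJ) //.
rewrite subsetI setSI // andbT (subset_trans (subsetIl _ _)) //.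
by rewrite (subset_trans sYHH) // commgS.
Qed.

Lemma lcn_special_gen n :
  L n \subset << (\bigcup_(H in s) (H :&: L n)) :|: L n.+1 >>.
Proof.
elim: n => [|[|n] IHn].
- by rewrite sub_gen // subsetUr.
- rewrite -{1}[L 1]genK genS // subsetU // (_ : _ \subset _) //.
  apply/bigcupsP=> H sH; rewrite (bigcup_max H) // subsetI subxx.
  exact: sHK.
set W := << _ >>.
have sWL : W \subset L n.+2.
  rewrite gen_subG subUset lcn_subS andbT.
  by apply/bigcupsP=> H _; apply: subsetIr.
have sLW : L n.+3 \subset W by rewrite sub_gen // subsetUr.
have nWK : K \subset 'N(W).
  by rewrite -commg_subl (subset_trans _ sLW) // [L n.+3]lcnSn commSg.
rewrite [L n.+2]lcnSn; apply: subset_trans (commSg _ IHn) _.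
rewrite -[X in [~: _, X]]genK; apply: (commG_gen_sub (W := <<_>>%G)) => [||x y].
- rewrite (subset_trans _ nWK) // subUset (lcn_sub n.+2) andbT.
  by apply/bigcupsP=> H _; rewrite subIset // orbC lcn_sub.
- by apply/bigcupsP=> H sH; apply: subset_trans (sHK sH) nWK.
move=> Xx /bigcupP[H' sH' Hy]; case/setUP: Xx => [|Lx]; last first.
  by apply: (subsetP sLW); rewrite [L n.+3]lcnSn mem_commg // (subsetP (sHK sH')).
case/bigcupP=> H sH /setIP[Hx Lx].
pose Y := [~: H :&: L n.+1, H']%G.
have nYA : A \subset 'N(Y).
  by rewrite normsR ?(special_norm abelA nGA sH') // normsI ?nLA ?(special_norm abelA nGA sH).
have sYL : Y \subset L n.+2 by rewrite [L n.+2]lcnSn commgSS ?subsetIr ?sHK.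
have sYH : Y \subset [~: H, H'] by rewrite commSg // subsetIl.
have Yxy : [~ x, y] \in Y by rewrite mem_commg // inE Hx.
apply: (subsetP (genS _)) (subsetP (special_comm_gen sH sH' sYH nYA) _ Yxy).
apply: subset_trans (subsetUl _ _); apply/bigcupsP=> J sJ.
by rewrite (bigcup_max J) // setIS.
Qed.

Let top : lat := valued (fun=> K).

Lemma le_top (W : lat) : lle W top.
Proof.
move=> n f _; apply: cspan_gen => u; exists (lrep (f u)); last by rewrite lrepK.
by rewrite inE lrep_mem (subsetP (lcn_sub n K)) ?lrep_mem.
Qed.

Lemma lact_valued X H n :
  lle (lact (valued (fun=> X)) (valued (fun=> H)) n)
      (valued (fun=> iter n (fun Y => [~: Y, H]%G) X)).
Proof.
elim: n => [|n IHn]; first exact: lle_refl.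
apply: lle_trans (lmul_monol _ IHn) (mul_valued_le _) => i j x y Yx Lx Hy Ly.
by apply: gmem_valued; rewrite ?group1 ?(mem_commg_lcn (erefl _)) //= mem_commg.
Qed.

(** The Lie ring is the sum of the images of the ['C_K(B)]. For each [B], some [a] puts ['C_K(B)] in
    ['C_G[a]] and [H] in its normal subgroup ['L_m.+1('C_G[a])]. The first commutator enters that
    subgroup, and [c] more exhaust its class. *)
Lemma special_act_nil H : H \in s ->
  lle (lact top (valued (fun=> H)) c.+1) (lbot lat).
Proof.
move=> sH; pose P (W : lat) := exists2 B, B \in hs & W = valued (fun=> 'C_K(B)).
have topP : lle top (lsup P).
  apply: valued_le => n x _ Lx.
  have p'L : p^'.-group (L n) := pgroupS (lcn_sub n K) p'K.
  move: (Lx); rewrite -(coprime_gen_cent_large pr_p abelA p'L (nLA n)); move: x {Lx}.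
  apply: gmem_gen => [|x /bigcupP[B hB /setIP[Lx Cx]]].
    by apply/bigcupsP=> B _; apply: subsetIl.
  apply: gmem_le (lsup_ub _) _; first by exists B; first exact: hB.
  by apply: gmem_valued; rewrite ?group1 // inE Cx (subsetP (lcn_sub n K)).
apply: (lle_trans (y := lact (lsup P) (valued (fun=> H)) c.+1)).
  exact: lact_mono topP (lle_refl _).
apply: lact_sup => _ [B hB ->].
have [a [Aa Ba sHT]] := special_meet ltpA sH hB.
apply: lle_trans (@lact_valued ('C_K(B))%G H c.+1) _; apply: valued_le => n x Yx _.
suff sY1 : iter c.+1 (fun Y => [~: Y, H]%G) ('C_K(B))%G \subset [1 gT].
  by have /set1P-> := subsetP sY1 x Yx; apply: gmem_lcnS; apply: group1.
rewrite -(classC Aa); elim: (c) => [|t IHt] /=.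
  apply: subset_trans (commgS _ sHT) _; rewrite commg_subr.
  apply: subset_trans (lcn_norm _ _); apply: setISS (sKG) _.
  by rewrite /= -cent_set1 centS ?sub1set.
by rewrite lcnSn commgSS.
Qed.

(** * The Engel-type bound for chains of A-invariant subgroups *)

Section Chain.

Variables (D : nat -> nat -> {group gT}) (d : nat).
Hypothesis nDA : forall e n, A \subset 'N(D e n).
Hypothesis commD : forall e i j, [~: D e i :&: L i, D e j :&: L j] \subset D e.+1 (i + j).
Hypothesis decD : forall e n, D e.+1 n \subset D e n.
Hypothesis D_d : forall n, D d n :&: L n \subset L n.+1.

Lemma special_engel :
  lle (lact top (lsums s (fun H => valued (fun n => H :&: D 0 n))) (engel_bound b c d))
      (lbot lat).
Proof.
apply: (engel_bounded (V := fun H => valued (fun=> H))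
          (Ve := fun e H => valued (fun n => H :&: D e n))).
- exact: size_special.
- exact: special_act_nil.
- move=> e H sH; apply: valued_le => n x /setIP[Hx _] Lx.
  by apply: gmem_valued; rewrite ?group1.
- exact: le_top.
- move=> e H H' sH sH'; apply: mul_valued_le => i j x y.
  case/setIP=> Hx Dx Lx /setIP[Hy Dy] Ly.
  pose Y := [~: H :&: D e i :&: L i, H' :&: D e j :&: L j]%G.
  have nYA : A \subset 'N(Y).
    by rewrite normsR // !normsI ?nDA ?nLA ?(special_norm abelA nGA sH) ?(special_norm abelA nGA sH').
  have sYH : Y \subset [~: H, H'] by rewrite commgSS // -setIA subsetIl.
  have sYD : Y \subset D e.+1 (i + j).
    by rewrite (subset_trans _ (commD e i j)) // commgSS // setSI // subsetIr.
  have sYL : Y \subset L (i + j).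
    by rewrite (subset_trans _ (commg_lcn K i j)) // commgSS // subsetIr.
  have Yxy : [~ x, y] \in Y by rewrite mem_commg // !inE ?Hx ?Dx ?Hy ?Dy.
  have := subsetP (special_comm_gen sH sH' sYH nYA) _ Yxy.
  apply: gmem_gen => [|z /bigcupP[J sJ /setIP[Jz Yz]]].
    by apply/bigcupsP=> J _; rewrite subIset // sYL orbT.
  apply: gmem_le (lsup_ub _) _; first by exists J; first exact: sJ.
  apply: gmem_valued; rewrite ?group1 ?(subsetP sYL) // inE Jz.
  exact: (subsetP sYD).
- move=> e; apply: lsup_lub => _ [H sH ->]; apply: lle_trans (lsup_ub _); last by exists H.
  apply: valued_le => n x /setIP[Hx Dx] Lx.
  by apply: gmem_valued; rewrite ?group1 // inE Hx (subsetP (decD e n)).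
apply: lsup_lub => _ [H sH ->]; apply: valued_le => n x /setIP[Hx Dx] Lx.
by apply: gmem_lcnS; apply: (subsetP (D_d n)); rewrite inE Dx.
Qed.

End Chain.

(** * The grading defined by an element a of A *)

Section Eigen.

Variable a : gT.
Hypothesis Aa : a \in A^#.

Let Aa' : a \in A. Proof. by case/setD1P: Aa. Qed.
Let ap1 : a ^+ p = 1. Proof. by case/(abelemP pr_p): abelA => _ ->. Qed.
Let nLa n i : a ^+ i \in 'N(L n). Proof. by rewrite groupX // (subsetP (nLA n)). Qed.

Let nCaA : A \subset 'N('C_K[a]).
Proof.
rewrite normsI ?nKA // (subset_trans _ (normG _)) //.
by rewrite sub_cent1 (subsetP (abelem_abelian abelA)).
Qed.

Definition fixed_part : lat := lsums s (fun H => valued (fun=> H :&: 'C_K[a])).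

(** The chain is the derived series of ['C_K[a]]: [m] steps lead into ['L_m.+1('C_G[a])], and [c]
    further ones to [1]. *)
Lemma fixed_engel : lle (lact top fixed_part (engel_bound b c (m + c))) (lbot lat).
Proof.
apply: (special_engel (D := fun e _ => 'C_K[a]^`(e)%G)) => [e n|e i j|e n|n] /=.
- exact: char_norm_trans (der_char e _) nCaA.
- by rewrite commgSS // subsetIl.
- exact: der_subS.
rewrite (subset_trans (subsetIl _ _)) // -der_add (subset_trans _ (sub1G _)) //.
rewrite -(classC Aa) (subset_trans _ (der_sub_lcn _ _)) // dergS //.
by rewrite (subset_trans _ (der_sub_lcn _ _)) // dergS // setSI.
Qed.

Lemma lproj_fixed n Y y : Y \subset L n -> a \in 'N(Y) -> y \in Y ->
    lproj K n (y ^ a) = lproj K n y ->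
  exists2 y', y' \in 'C_Y[a] & lproj K n y' = lproj K n y.
Proof.
move=> sYL nYa Yy eq_ya; pose N := 'L_n.+1(K)%G.
have [nN sYN] : <[a]> \subset 'N(N) /\ Y \subset 'N(N).
  split; first by rewrite cycle_subG (subsetP (nLA _)).
  by rewrite (subset_trans sYL) // (subset_trans (lcn_sub n K)) // lcn_norm.
have pZ : p.-group <[a]>.
  by apply: pgroupS (abelem_pgroup abelA); rewrite cycle_subG.
(* [Y] need not contain [N], hence the form of coprime lifting that only involves [N :&: [~: Y,
   <[a]>]]. *)
have sRY : N :&: [~: Y, <[a]>] \subset Y by rewrite subIset // commg_subl cycle_subG nYa orbT.
have coR : coprime #|N :&: [~: Y, <[a]>]| #|<[a]>|.
  apply: p'nat_coprime pZ; apply: pgroupS p'K.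
  by rewrite (subset_trans sRY) // (subset_trans sYL) // lcn_sub.
have solZ : solvable (N :&: [~: Y, <[a]>]) || solvable <[a]> by rewrite (pgroup_sol pZ) orbT.
have defC := strongest_coprime_quotient_cent nN sRY coR solZ.
have Ly := subsetP sYL y Yy; have Lya : y ^ a \in L n by rewrite memJ_norm ?(nLa n 1).
have nNa : a \in 'N(N) by apply: (nLa _ 1).
have nNy := subsetP sYN y Yy.
have : coset N y \in 'C_Y(<[a]>) / N.
  rewrite defC inE mem_quotient //= quotient_cycle // cent_cycle.
  apply/cent1P/commgP; rewrite commgEl -eq_mulVg1 -morphJ // eq_sym; apply/eqP.
  by have := congr1 val eq_ya; rewrite /lproj !fmodK ?mem_quotient.
case/morphimP=> y' nNy' /setIP[Yy' Cy'] def_y'; exists y'.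
  by rewrite inE Yy' -cent_cycle.
by rewrite /lproj -def_y'.
Qed.

Let expa (i : 'F_p) : a ^+ (i + 1)%R = a ^+ i * a.
Proof. by rewrite (expg_Fp pr_p ap1 _ _).1. Qed.

Definition ltrace n z : lcn_lie K n := (\sum_(i : 'F_p) lproj K n (z ^ (a ^+ i)))%R.

Lemma ltraceM n : {in L n &, {morph ltrace n : x y / x * y >-> (x + y)%R}}.
Proof.
move=> x y Lx Ly; rewrite /ltrace -big_split; apply: eq_bigr => i _.
by rewrite conjMg lprojM // memJ_norm.
Qed.

(** The product of the conjugates of [z] lies in [Y] and has an [a]-invariant image; by coprimality
    a fixed element of [Y] has the same image. *)
Lemma ltrace_rep n Y z : Y \subset L n -> a \in 'N(Y) -> z \in Y ->
  exists2 y, y \in 'C_Y[a] & lproj K n y = ltrace n z.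
Proof.
move=> sYL nYa Yz; pose y := \prod_(i : 'F_p) z ^ (a ^+ i).
have prodE (F : 'F_p -> gT) : (forall i, F i \in L n) ->
    lproj K n (\prod_i F i) = (\sum_i lproj K n (F i))%R.
  move=> LF; suff [] : \prod_i F i \in L n /\
    lproj K n (\prod_i F i) = (\sum_i lproj K n (F i))%R by [].
  apply: (big_rec2 (fun x v => x \in L n /\ lproj K n x = v)).
    by rewrite group1 lproj1.
  by move=> i v x _ [Lx <-]; rewrite groupM ?lprojM.
have Yzi i : z ^ (a ^+ i) \in Y by rewrite memJ_norm // groupX.
have Yy : y \in Y by apply: group_prod => i _; apply: Yzi.
have Ly := prodE _ (fun i => subsetP sYL _ (Yzi i)).
have [|y' Cy' eq_y'] := lproj_fixed sYL nYa Yy; last by exists y'; rewrite // eq_y' Ly.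
have -> : y ^ a = \prod_(i : 'F_p) z ^ (a ^+ (i + 1)%R).
  by rewrite /y (big_morph (conjg^~ a) (fun u v => conjMg u v a) (conj1g a));
     apply: eq_bigr => i _; rewrite -conjgM expa.
rewrite prodE => [|i]; last exact: subsetP sYL _ (Yzi _).
by rewrite Ly [RHS](reindex_inj (addIr (1 : 'F_p)%R)).
Qed.

Lemma lgr_annihil n (v : lcn_lie K n) : (v *+ #|K| = 0)%R.
Proof.
rewrite -[v](lrepK (v : lgr K n)); set x := lrep _.
have Kx : x \in K by rewrite (subsetP (lcn_sub n K)) // lrep_mem.
have Lx i : x ^+ i \in L n by rewrite groupX // lrep_mem.
suff -> : (lproj K n x *+ #|K| = lproj K n (x ^+ #|K|))%R by rewrite expg_cardG // lproj1.
elim: #|K| => [|i IHi]; first by rewrite lproj1.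
by rewrite mulrS IHi expgS (lprojM (lrep_mem _) (Lx i)).
Qed.

(** Multiplication by [p] is invertible, because [#|K|] kills every section and is prime to [p]. *)
Lemma cspan_divp n (S : fgl (lcn_lie K) p n -> Prop) (f : fgl (lcn_lie K) p n) :
  cspan S (f *+ p)%R -> cspan S f.
Proof.
have co_p : coprime p #|K| by rewrite prime_coprime // -p'natE.
have [q r def_q _] := egcdnP #|K| (prime_gt0 pr_p).
rewrite (eqP (co_p : gcdn p #|K| == 1%N)) in def_q => Sfp.
suff -> : f = (f *+ p *+ q)%R.
  by elim: q {def_q} => [|q IHq]; [apply: cspan0 | rewrite mulrS; apply: cspan_add].
rewrite -mulrnA mulnC def_q mulrnDr mulrnA mulrnAC.
rewrite (_ : (f *+ #|K| = 0)%R) ?mul0rn ?add0r //.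
by apply/ffunP=> u; rewrite ffunMnE lgr_annihil ffunE.
Qed.

Lemma ltrace_fixed n z u : z \in L n ->
  cspan (@fixed_part n) (fdelta (g := lcn_lie K) (p := p) u (ltrace n z)).
Proof.
move=> Lz; have /gen_prodgP[k [w Ww ->]] := subsetP (lcn_special_gen n) z Lz.
suff [] : \prod_i w i \in L n /\
  cspan (@fixed_part n) (fdelta (g := lcn_lie K) (p := p) u (ltrace n (\prod_i w i))) by [].
elim/big_ind: _ => [|x y [Lx Fx] [Ly Fy]|i _].
- rewrite group1 /ltrace big1 ?fdelta0 => [|i _]; last by rewrite conj1g lproj1.
  by split=> //; apply: cspan0.
- by rewrite groupM // ltraceM // fdeltaD; split=> //; apply: cspan_add.
case/setUP: (Ww i) => [/bigcupP[H sH /setIP[Hw Lw]]|Lw].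
  split=> //; have nYa : a \in 'N(H :&: L n).
    by rewrite (subsetP _ _ Aa') // normsI ?nLA // (special_norm abelA nGA sH).
  have Yw : w i \in H :&: L n by rewrite inE Hw.
  have [y Cy <-] := ltrace_rep (Y := (H :&: L n)%G) (subsetIr _ _) nYa Yw.
  have /setIP[/setIP[Hy Ly] Cay] := Cy.
  have : gmem (valued (fun=> H :&: 'C_K[a])) n y.
    apply: gmem_valued; rewrite ?group1 //.
    by rewrite inE Hy inE (subsetP (lcn_sub n K) _ Ly).
  by move/gmem_le; apply; apply: lsup_ub; exists H.
have Lw' := subsetP (lcn_subS n K) _ Lw; split=> //.
rewrite /ltrace big1 ?fdelta0 => [|j _]; first exact: cspan0.
by apply/eqP; rewrite lproj_eq0 memJ_norm.
Qed.

(** [p] times a fixed element is its trace, and traces can be computed on the generators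
    [H :&: L n]. So [fixed_part] captures all fixed points, though it is built from special
    subgroups only. *)
Lemma gmem_fixed n x : x \in 'C_(L n)[a] -> gmem fixed_part n x.
Proof.
case/setIP=> Lx Cax u; apply: cspan_divp.
have -> : (fdelta (g := lcn_lie K) (p := p) u (lproj K n x) *+ p =
            fdelta u (ltrace n x))%R.
  apply/ffunP=> w; rewrite ffunMnE !ffunE; case: eqP => _; last by rewrite mul0rn.
  rewrite /ltrace (eq_bigr (fun=> lproj K n x)) => [|i _].
    by rewrite sumr_const cardT -cardE card_Fp.
  by congr lproj; apply/conjg_fixP/commgP/commuteX; apply/cent1P.
exact: ltrace_fixed.
Qed.

Definition lact_rel n (v w : lcn_lie K n) :=
  exists2 x, x \in L n & v = lproj K n x /\ w = lproj K n (x ^ a).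

(** Translation by [r%:R] is multiplication by the [r]-th power of the generator of the group ring,
    so [a] acts on these functions as that scalar. *)
Definition eigen (r : nat) : lat :=
  fun n f => forall u, lact_rel (f u) (f (u - r%:R)%R).

Lemma eigen0_le : lle (eigen 0) fixed_part.
Proof.
move=> n f f0; rewrite [f]fdelta_sum; apply: cspan_sum => u _.
have [x Lx [fx]] := f0 u; rewrite subr0 fx => /esym eq_x.
have [x' Cx' <-] := lproj_fixed (subxx (L n)) (nLa n 1) Lx eq_x.
exact: gmem_fixed.
Qed.

Lemma lact_rel_sum n (I : Type) (r : seq I) (F F' : I -> lcn_lie K n) :
  (forall i, lact_rel (F i) (F' i)) -> lact_rel (\sum_(i <- r) F i)%R (\sum_(i <- r) F' i)%R.
Proof.
move=> FF'; apply: (big_ind2 (@lact_rel n)) => // [|v v' w w' [x Lx [-> ->]] [y Ly [-> ->]]].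
  by exists 1; rewrite ?group1 // conj1g lproj1.
exists (x * y); first exact: groupM.
have Jn z : z \in L n -> z ^ a \in L n by rewrite memJ_norm ?(nLa n 1).
by rewrite conjMg (lprojM Lx Ly) (lprojM (Jn x Lx) (Jn y Ly)).
Qed.

Lemma lact_rel_br i j n (v v' : lcn_lie K i) (w w' : lcn_lie K j) : n = (i + j)%N ->
  lact_rel v v' -> lact_rel w w' -> lact_rel (br n v w) (br n v' w').
Proof.
move=> dn [x Lx [-> ->]] [y Ly [-> ->]].
exists [~ x, y]; first exact: mem_commg_lcn dn Lx Ly.
have Jn k z : z \in L k -> z ^ a \in L k by rewrite memJ_norm ?(nLa k 1).
by split; [exact: lbrE | rewrite conjRg; exact: lbrE dn (Jn _ _ Lx) (Jn _ _ Ly)].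
Qed.

Lemma eigen_graded : graded p eigen.
Proof.
move=> r t ltr ltt n _ [i [j [f [h [dn fr ht ->]]]]].
apply: cspan_gen => u; rewrite !ffunE.
have -> : (((r + t) %% p)%:R = r%:R + t%:R :> 'F_p)%R by rewrite Fp_nat_mod // natrD.
rewrite [X in lact_rel _ X](reindex_inj (addIr (- r%:R)%R)) /=.
apply: lact_rel_sum => w; apply: lact_rel_br => //.
rewrite (_ : (u - (r%:R + t%:R) - (w - r%:R) = u - w - t%:R)%R) //.
by ring.
Qed.

(* Discrete Fourier inversion, up to the constants and the factor p. *)
Lemma top_eigen_le : lle top (lsup (fun W => exists2 r, (r < p)%N & W = eigen r)).
Proof.
set S := lsup _; move=> n f _; apply: cspan_divp.
pose x w := lrep (f w); have Lx w : x w \in L n by apply: lrep_mem.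
pose h w i : lcn_lie K n := lproj K n (x w ^ (a ^+ i)).
(* The component of [f] in [eigen j], up to the factor [p]. *)
pose e (j : 'F_p) : fgl (lcn_lie K) p n := [ffun u => \sum_(i : 'F_p) h (u + i * j) i]%R.
(* In the sum of the [e j], the terms with [i = 0] give [p] times [f]; for [i != 0] the argument
   [u + i * j] runs over all of ['F_p], giving a constant. *)
pose k : fgl (lcn_lie K) p n :=
  [ffun _ => \sum_(i : 'F_p | i != 0) \sum_(w : 'F_p) h w i]%R.
have eS j : cspan (@S n) (e j).
  apply: cspan_gen; exists (eigen j).
    by exists (val j) => //; rewrite -[X in (_ < X)%N](Fp_cast pr_p); apply: ltn_ord.
  move=> u; rewrite natr_Zp !ffunE.
  rewrite [X in lact_rel _ X](reindex_inj (addIr (1 : 'F_p)%R)) /=.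
  apply: lact_rel_sum => i; exists (x (u + i * j)%R ^ (a ^+ i)); first by rewrite memJ_norm.
  split=> //; rewrite (_ : (u - j + (i + 1) * j = u + i * j)%R); last by ring.
  by rewrite /h expa conjgM.
have -> : (f *+ p = \sum_j e j - k)%R.
  apply/ffunP=> u; rewrite ffunMnE !ffunE sum_ffunE.
  under eq_bigr do rewrite ffunE.
  rewrite exchange_big (bigD1 0%R) //=.
  rewrite [X in (_ + X - _)%R](eq_bigr (fun i : 'F_p => \sum_(w : 'F_p) h w i)%R) => [|i nz_i].
    rewrite addrK (eq_bigr (fun=> f u)) => [|j _].
      by rewrite sumr_const cardT -cardE card_Fp.
    by rewrite mul0r addr0 /h expg0 conjg1; apply: lrepK.
  rewrite [RHS](reindex_inj (addrI u)) [RHS](reindex_inj (mulfI nz_i)) //.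
apply: cspan_add; first exact: cspan_sum.
by apply/cspan_opp/cspan_const => u v; rewrite !ffunE.
Qed.

Definition soluble_length := kreknin_length p (engel_bound b c (m + c)).

Lemma eigen_soluble r : (r < p)%N -> lle (iter soluble_length (derg p) eigen r) (lbot lat).
Proof.
move=> ltr; apply: kreknin => // [||t _]; first exact: prime_gt0.
  exact: eigen_graded.
apply: (lle_trans (y := lact top fixed_part (engel_bound b c (m + c)))); last exact: fixed_engel.
by apply: lact_mono; [apply: le_top | apply: eigen0_le].
Qed.

End Eigen.

(** The derived series of the Lie ring, lifted degree by degree to subgroups of [K]; being
    [A]-invariant, these can be intersected with special subgroups to form a chain. *)
Fixpoint lie_der (e n : nat) : {group gT} :=
  if e is e'.+1 then
    << \bigcup_(i < n.+1) [~: lie_der e' i :&: L i, lie_der e' (n - i) :&: L (n - i)] >>%G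
  else 'L_n(K)%G.

Let lie_der_norm e n : A \subset 'N(lie_der e n).
Proof.
elim: e n => [|e IHe] n; first exact: nLA.
by rewrite norms_gen // norms_bigcup //; apply/bigcapsP=> i _; rewrite normsR // normsI ?IHe ?nLA.
Qed.

Let lie_der_comm e i j :
  [~: lie_der e i :&: L i, lie_der e j :&: L j] \subset lie_der e.+1 (i + j).
Proof.
have lti : (i < (i + j).+1)%N by rewrite ltnS leq_addr.
by rewrite sub_gen // (bigcup_max (Ordinal lti)) //= addKn.
Qed.

Let lie_der_dec e n : lie_der e.+1 n \subset lie_der e n.
Proof.
elim: e n => [|e IHe] n; rewrite gen_subG; apply/bigcupsP=> i _.
  rewrite (subset_trans (commgSS (subsetIr _ _) (subsetIr _ _))) //.
  rewrite (subset_trans (commg_lcn K i (n - i))) //.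
  by rewrite subnKC // -ltnS.
by rewrite sub_gen // (bigcup_max i) // commgSS ?setSI ?IHe.
Qed.

Lemma lie_der_eigen a e : a \in A^# ->
  lle (valued (lie_der e))
      (lsup (fun W => exists2 r, (r < p)%N & W = iter e (derg p) (eigen a) r)).
Proof.
move=> Aa; elim: e => [|e IHe].
  by apply: lle_trans (top_eigen_le Aa); apply: le_top.
set S := lsup _ in IHe *; set S' := lsup _.
have SS : lle (lmul S S) S'.
  apply: lmul_supl => _ [r ltr ->]; apply: lmul_supr => _ [t ltt ->].
  apply: lle_trans (mul_derg _ ltr ltt) (lsup_ub _); exists ((r + t) %% p)%N => //.
  by rewrite ltn_pmod ?prime_gt0.
apply: valued_le => n x /= Dx _; move: x Dx.
apply: gmem_gen => [|x /bigcupP[i _]].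
  apply/bigcupsP=> i _; rewrite (subset_trans (commgSS (subsetIr _ _) (subsetIr _ _))) //.
  by rewrite (subset_trans (commg_lcn K i (n - i))) // subnKC // -ltnS.
move: x; apply: gmem_gen => [|_ /imset2P[x y /setIP[Dx Lx] /setIP[Dy Ly] ->]].
  rewrite -gen_subG (subset_trans (commgSS (subsetIr _ _) (subsetIr _ _))) //.
  by rewrite (subset_trans (commg_lcn K i (n - i))) // subnKC // -ltnS.
have dn : (i + (n - i))%N = n by rewrite subnKC // -ltnS.
rewrite -[X in gmem _ X _]dn; apply: gmem_le SS _; apply: mul_gmem => //.
  by apply: gmem_le IHe _; apply: gmem_valued; rewrite ?group1.
by apply: gmem_le IHe _; apply: gmem_valued; rewrite ?group1.
Qed.

Definition class_bound := engel_bound b c soluble_length.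

(** The series [lie_der] vanishes by Kreknin's theorem for one chosen [a], so the Engel-type bound
    applies to it, starting from the whole Lie ring. *)
Lemma lie_ring_nilpotent : lle (lact top top class_bound) (lbot lat).
Proof.
have [a Aa] : exists a, a \in A^#.
  by apply/set0Pn; rewrite setD_eq0 subG1 -cardG_gt1 (leq_ltn_trans _ ltpA) // expn_gt0 prime_gt0.
pose M := lsums s (fun H => valued (fun n => H :&: lie_der 0 n)).
have topM : lle top M.
  apply: valued_le => n x _ Lx; move: (subsetP (lcn_special_gen n) x Lx); move: x {Lx}.
  apply: gmem_gen => [|x /setUP[/bigcupP[H sH /setIP[Hx Lx]]|Lx]].
  - by rewrite subUset lcn_subS andbT; apply/bigcupsP=> H _; apply: subsetIr.
  - apply: gmem_le (lsup_ub _) _; first by exists H; first exact: sH.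
    by apply: gmem_valued; rewrite ?group1 // inE Hx.
  - exact: gmem_lcnS.
apply: lle_trans (lact_mono _ (lle_refl top) topM) _.
apply: special_engel => // n; apply/subsetP=> x /setIP[Dx Lx].
apply: (gmem_bot (p := p) Lx); have : gmem (valued (lie_der soluble_length)) n x.
  by apply: gmem_valued; rewrite ?group1.
apply: gmem_le; apply: lle_trans (@lie_der_eigen a soluble_length Aa) _.
by apply: lsup_lub => _ [r ltr ->]; apply: eigen_soluble.
Qed.

Lemma gmem_lact_top t z : z \in L t.+1 -> gmem (lact top top t) t.+1 z.
Proof.
elim: t z => [|t IHt] z Lz; first by apply: gmem_valued; rewrite ?group1.
move: z Lz; rewrite [L t.+2]lcnSn.
apply: gmem_gen => [|_ /imset2P[x y Lx Ky ->]].
  by rewrite -gen_subG; apply: (lcnSnS t.+1 K).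
rewrite -[t.+2]addn1; apply: mul_gmem => //; first exact: IHt.
by apply: gmem_valued; rewrite ?group1.
Qed.

(** The Lie ring only shows that the lower central series of [K] is stationary at [class_bound.+1];
    nilpotency of [K] then makes this term trivial. *)
Lemma lcn_class_bound : nilpotent 'L_m.+1(G) /\ 'L_class_bound.+1('L_m.+1(G)) = 1.
Proof.
have nilK : nilpotent K.
  apply: (nilpotent_lcn_of_cent pr_p abelA p'G nGA ltpA) => a Aa.
  by apply/lcnP; exists c; apply: classC.
split=> //; have := nilK; rewrite /nilpotent => /forall_inP/(_ 'L_class_bound.+1(K)%G).
rewrite subsetI lcn_sub /= => nil1; apply/eqP/nil1.
apply/subsetP=> z Lz; rewrite -[[~: _, _]]/(L class_bound.+2).
apply: (gmem_bot (p := p) Lz).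
exact: gmem_le lie_ring_nilpotent (gmem_lact_top _).
Qed.

End ClassBound.

(** * From group actions to conjugation in the semidirect product *)

Section Transfer.
Local Open Scope group_scope.

Lemma injm_lcn_nil_class (aT rT : finGroupType) (D G : {group aT})
    (f : {morphism D >-> rT}) m c :
    'injm f -> G \subset D ->
  (nilpotent 'L_m(G) /\ nil_class 'L_m(G) <= c) <->
  (nilpotent 'L_m(f @* G) /\ 'L_c.+1('L_m(f @* G)) = 1).
Proof.
move=> injf sGD; have sLD : 'L_m(G) \subset D := subset_trans (lcn_sub m G) sGD.
rewrite -morphim_lcn // injm_nil // -(nil_class_injm injf sLD).
have nilP := lcn_nil_classP c.
by split=> -[nilG clG]; split=> //; apply/nilP; rewrite ?injm_nil.
Qed.

Lemma cent_sdpair (aT rT : finGroupType) (A : {group aT}) (G : {group rT})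
    (to : groupAction A G) a : a \in A ->
  sdpair1 to @* 'C_(G | to)[a] = 'C_(sdpair1 to @* G)[sdpair2 to a].
Proof.
by move=> Aa; rewrite gacentEsd morphim_setIpre morphim_set1 // cent_set1.
Qed.

End Transfer.

Theorem theorem4p1 :
  exists f : nat -> nat -> nat -> nat,
  forall (c p k : nat), 0 < c -> prime p -> 3 <= k ->
  forall (aT rT : finGroupType) (A : {group aT}) (G : {group rT})
         (to : groupAction A G),
  (p.-abelem A)%g -> #|A| = p ^ k -> (p^'.-group G)%g ->
  (forall a : aT, a \in (A^#)%g ->
     nilpotent ('L_(k - 2)('C_(G | to)[a]))%g /\
     nil_class ('L_(k - 2)('C_(G | to)[a]))%g <= c) ->
  nilpotent ('L_(k - 2)(G))%g /\ nil_class ('L_(k - 2)(G))%g <= f c k p.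
Proof.
(* The bound on the number of special subgroups, with [#|A| = p ^ k] and [m = k - 3], as
   ['L_(k - 2)] is ['L_m.+1]. *)
pose b p k := (2 ^ (p ^ k)) ^ (k - 3).*2.+1.
exists (fun c k p => engel_bound (b p k) c
          (kreknin_length p (engel_bound (b p k) c (k - 3 + c)))).
move=> c p k _ pr_p; case: k => [|[|[|m]]] // _ aT rT A G to abelA oA p'G classC.
set N := engel_bound _ _ _; have {N}-> : N = class_bound p m c A.
  by rewrite /N /b /class_bound /soluble_length oA !subSS subn0.
rewrite !subSS subn0 in classC *.
have injG := injm_sdpair1 to; have injA := injm_sdpair2 to.
apply/(injm_lcn_nil_class _ _ injG (subxx G)).
have nGA := im_sdpair_norm to; have abelA1 := morphim_abelem (sdpair2 to) abelA.
have p'G1 := morphim_pgroup (sdpair1 to) p'G.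
have oA1 : #|(sdpair2 to @* A)%g| = #|A| by rewrite card_injm.
have -> : class_bound p m c A = class_bound p m c (sdpair2 to @* A)%G.
  by rewrite /class_bound /soluble_length oA1.
apply: lcn_class_bound => //; first by rewrite /= oA1 oA ltn_exp2l ?prime_gt1.
move=> a1 /setD1P[nta1 /morphimP[a _ Aa def_a]]; rewrite {a1}def_a in nta1 *.
have Aa1 : a \in (A^#)%g.
  by rewrite !inE Aa andbT; apply: contra nta1 => /eqP->; rewrite morph1.
have sCG : 'C_(G | to)[a]%g \subset G by apply: subsetIl.
have [_] := (injm_lcn_nil_class m.+1 c injG sCG).1 (classC a Aa1).
by rewrite cent_sdpair.
Qed.
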